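(* Let $\Bbbk \subset \mathbb{R}$ be a subring, $(W,S)$ a Coxeter system, and $V$ a realization of $(W,S)$ over $\Bbbk$ on which $W$ acts faithfully. Suppose that $W$ preserves the almost-orthant over $k = \mathbb{Z}$ spanned by $(X,H)$, and let $\Gamma$ be the associated transposition graph. Then $W$ is a finite product of symmetric groups and affine Weyl groups $W_C$, one for each connected component $C$ of $\Gamma$. Moreover, $$V \cong \Bigl(Z \oplus \bigoplus_C P_C\Bigr)/K,$$ where $P_C$ is the permutation representation (if $C$ is of finite type) or the affine permutation representation (if $C$ is of affine type) of $W_C$, inflated from this subgroup to $W$; $Z$ is the free $\Bbbk$-module on a set $H'$ in bijection with $H$, acted on trivially by $W$; and $K$ is the subspace of the $W$-invariants spanned by the elements $k_C = \hbar_C - v_C$, one for each affine-type component $C$. Here $\hbar_C \in P_C$ is the sum of the simple roots of the affine permutation representation $P_C$ (that is, its basis element $\hbar$), and $v_C \in Z$ is the preimage of $(\sum\alpha)_C \in \operatorname{Span} H$ under the isomorphism $Z \cong \operatorname{Span}_{\Bbbk} H$ induced by the bijection $H' \leftrightarrow H$, where $(\sum\alpha)_C$ is the sum of the simple roots in $V$ associated to the edges in $C$.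
   Context: Realization: Let $\Bbbk$ be a commutative domain, $V$ a free $\Bbbk$-module, $V^* = \operatorname{Hom}_{\Bbbk}(V,\Bbbk)$, and $(W,S)$ a Coxeter system, with $m_{st}$ the order of $st$ in $W$. A realization of $(W,S)$ over $\Bbbk$ is the data of $V$ and, for each $s \in S$, of a simple root $\alpha_s \in V$ and a simple coroot $\alpha_s^\vee \in V^*$ such that (1) $\alpha_s^\vee(\alpha_s) = 2$; (2) for $s \neq t$, $\alpha_s^\vee(\alpha_t) = 0$ if and only if $m_{st} = 2$; (3) the assignment $s(v) := v - \alpha_s^\vee(v)\,\alpha_s$ defines a $\Bbbk$-linear action of $W$ on $V$. Almost-orthants (for $k=\mathbb{Z}$): $W$ preserves a (full) $\mathbb{Z}$-lattice $\Lambda$ if $\Lambda$ is the $\mathbb{Z}$-span of some $\Bbbk$-basis of $V$ and $\Lambda$ is preserved by $W$. Given such a $\Lambda$, let $X \sqcup H$ be a $\mathbb{Z}$-basis of $\Lambda$ such that every element of $H$ is fixed by $W$. The almost-orthant spanned by $(X,H)$ is the set of all sums $\sum_{x \in X} a_x x + \sum_{h \in H} c_h h$ with $a_x \in \mathbb{Z}_{\ge 0}$ and $c_h \in \mathbb{Z}$. ''$W$ preserves the almost-orthant spanned by $(X,H)$'' means that $W$ preserves such a $\Lambda$ and maps this subset of it to itself. Transposition graph: In this situation, each $s \in S$ acting nontrivially on $V$ fixes all elements of $X$ except for exactly two; denote this pair of non-fixed elements by $X_s$. The transposition graph $\Gamma$ has vertex set $X$, and for each $s \in S$ acting nontrivially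 on $V$ an unoriented edge $e_s$ joining the two elements of $X_s$ (multiple edges allowed). For a connected component $C$, $W_C$ is the parabolic subgroup of $W$ generated by the $s \in S$ whose edges lie in $C$ (trivial if $C$ is a single vertex); the simple roots associated to the edges in $C$ are the $\alpha_s$ for these $s$. Types of components: Under the hypotheses of the theorem each component $C$ is of one of the following types. Finite type: $C$ is a line (path) with $n \ge 1$ vertices, labeled $x_1,\dots,x_n$, with edges $s_1,\dots,s_{n-1}$, $X_{s_i} = \{x_i,x_{i+1}\}$; then $W_C \cong S_n$. Affine type: $C$ is a circle (cycle) with $n \ge 3$ vertices, or a lone double edge ($n = 2$ vertices joined by exactly two edges and joined to nothing else), with vertices labeled $x_1,\dots,x_n$ and edges $s_0,s_1,\dots,s_{n-1}$ such that $X_{s_i} = \{x_i,x_{i+1}\}$ for $1 \le i \le n-1$ and $X_{s_0} = \{x_n,x_1\}$; then $W_C$ is the affine Weyl group of type $\tilde{A}_{n-1}$ with simple reflections $s_0,\dots,s_{n-1}$. Without changing the almost-orthant, $X$ can be replaced by a normalized basis, in which $s_i(x_i) = x_{i+1}$ for $1 \le i \le n-1$ on each component; on an affine-type component one then has $s_0(x_n) = x_1 - \hbar$ for some $\hbar \in \operatorname{Span}_{\mathbb{Z}} H$, and this $\hbar$ is the element $(\sum\alpha)_C$, the sum of the simple roots associated to the edges in $C$. Permutation representation of $S_n$: the free $\Bbbk$-module with basis $x_1,\dots,x_n$ permuted by $S_n$. Affine permutation representation of $\tilde{A}_{n-1}$ ($n \ge 2$): the free $\Bbbk$-module with basis $x_1,\dots,x_n,\hbar$,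 where $\hbar$ is invariant; for $1 \le i \le n-1$, $s_i$ swaps $x_i$ and $x_{i+1}$ and fixes the other $x_j$; and $s_0(x_n) = x_1 - \hbar$, $s_0(x_1) = x_n + \hbar$, with $s_0$ fixing the other $x_j$. Its simple roots are $\alpha_i = x_i - x_{i+1}$ for $1 \le i \le n-1$ and $\alpha_0 = x_n - x_1 + \hbar$, whose sum is $\hbar$. Inflation from $W_C$ to $W$ is along the projection of the direct product $W$ onto its factor $W_C$.
   Formalization: It is assumed that S or X is finite (else W is not a finite product), and the isomorphism is stated when each (∑α)_C for affine C lies in Span H, so that v_C exists; it is also shown that rescaling the simple roots by units always achieves this. *)

(* Defs.v *)
From HB Require Import structures.
From mathcomp Require Import all_boot all_order all_algebra all_fingroup.
From mathcomp Require Import ring_quotient generic_quotient.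
From mathcomp Require Import all_classical all_reals.

Set Implicit Arguments.
Unset Strict Implicit.
Unset Printing Implicit Defensive.

Import GRing.Theory.

Local Open Scope classical_set_scope.
Local Open Scope ring_scope.
Local Open Scope quotient_scope.

(** * Groups and Coxeter systems *)

Section Groups.
Variable W : groupType.

Definition is_subgroup (G : set W) : Prop :=
  [/\ G 1%g, forall x y, G x -> G y -> G (x * y)%g & forall x, G x -> G (x^-1)%g].

Definition subgroup_generated (A : set W) : set W :=
  [set w | forall G, is_subgroup G -> A `<=` G -> G w].

Definition has_order (x : W) (m : nat) : Prop :=
  [/\ (0 < m)%N, (x ^+ m = 1)%g & forall j, (0 < j < m)%N -> (x ^+ j)%g <> 1%g].

(* W is presented by the generating set S of involutions, subject to the
   relations (st)^m = 1 where m is the (finite) order of st. *)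
Definition coxeter_system (S : set W) : Prop :=
  [/\ forall s, S s -> has_order s 2,
      subgroup_generated S = setT
    & forall (G : groupType) (f : W -> G),
        (forall s t m, S s -> S t -> has_order (s * t)%g m ->
           ((f s * f t) ^+ m = 1)%g) ->
        exists2 F : W -> G, {morph F : x y / (x * y)%g} &
          forall s, S s -> F s = f s].

End Groups.

(** * Spans, bases, quotients and direct sums of modules *)

Section Span.
Variables (A : pzRingType) (M : lmodType A).

Definition lspan (B : set M) : set M :=
  [set v | exists (r : seq M) (c : M -> A),
     (forall b, b \in r -> B b) /\ v = \sum_(b <- r) c b *: b].

Definition lin_indep (B : set M) : Prop :=
  forall (r : seq M) (c : M -> A), uniq r -> (forall b, b \in r -> B b) ->
    \sum_(b <- r) c b *: b = 0 -> forall b, b \in r -> c b = 0.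

Definition is_basis (L B : set M) : Prop := lin_indep B /\ lspan B = L.

Lemma span_inc (B : set M) b : B b -> lspan B b.
Proof.
move=> Bb; exists [:: b], (fun=> 1); split; first by move=> x /[!inE] /eqP ->.
by rewrite big_seq1 scale1r.
Qed.

Lemma spanZ (B : set M) a v : lspan B v -> lspan B (a *: v).
Proof.
move=> [r [c [rB ->]]]; exists r, (fun b => a * c b); split=> //.
by rewrite scaler_sumr; apply: eq_bigr => b _; rewrite scalerA.
Qed.

Lemma span0 (B : set M) : lspan B 0.
Proof. by exists [::], (fun=> 0); rewrite big_nil. Qed.

Lemma spanD (B : set M) u v : lspan B u -> lspan B v -> lspan B (u + v).
Proof.
move=> [r [c [rB ->]]] [q [d [qB ->]]].
exists (undup (r ++ q)).
exists (fun b => c b *+ count_mem b r + d b *+ count_mem b q); split.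
  by move=> b; rewrite mem_undup mem_cat => /orP[/rB|/qB].
have E (e : M -> A) (s t : seq M) : uniq t -> {subset s <= t} ->
    \sum_(b <- s) e b *: b = \sum_(b <- t) (e b *+ count_mem b s) *: b.
  move=> ut; elim: s => [|x s IH] st.
    by rewrite big_nil big1 // => b _; rewrite mulr0n scale0r.
  rewrite big_cons IH; last by move=> y ys; apply: st; rewrite inE ys orbT.
  rewrite (bigD1_seq x) ?st ?mem_head //= [in RHS](bigD1_seq x) ?st ?mem_head //=.
  rewrite eqxx mulrS scalerDl addrA; congr (_ + _).
  by apply: eq_bigr => b /negPf; rewrite eq_sym => ->.
rewrite (E c r (undup (r ++ q))) ?undup_uniq //; last first.
  by move=> x xr; rewrite mem_undup mem_cat xr.
rewrite (E d q (undup (r ++ q))) ?undup_uniq //; last first.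
  by move=> x xq; rewrite mem_undup mem_cat xq orbT.
by rewrite -big_split; apply: eq_bigr => b _ /=; rewrite scalerDl.
Qed.

Definition span_pred (B : set M) : {pred M} := fun v => `[< lspan B v >].

Fact span_zmod_closed B : zmod_closed (span_pred B).
Proof.
split=> [|u v]; first exact/asboolP/span0.
rewrite !unfold_in => /asboolP uB /asboolP vB; apply/asboolP/spanD => //.
by rewrite -scaleN1r; apply: spanZ.
Qed.

HB.instance Definition _ B := GRing.isZmodClosed.Build M (span_pred B)
  (span_zmod_closed B).

(* The quotient module M / span B. *)
Definition lquot (B : set M) := Quotient.quot (span_pred B).

HB.instance Definition _ B := GRing.Zmodule.on (lquot B).
HB.instance Definition _ B := EqQuotient.on (lquot B).

Section Lquot.
Variable B : set M.

Lemma lquot_eqP (x y : M) :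
  reflect (lspan B (x - y)) (\pi_(lquot B) x == \pi_(lquot B) y).
Proof. by rewrite -Quotient.idealrBE; apply: asboolP. Qed.

Lemma lquot_repr (x : M) : lspan B (repr (\pi_(lquot B) x) - x).
Proof. by apply/lquot_eqP; rewrite reprK. Qed.

Lemma lquotD (x y : M) :
  \pi_(lquot B) (x + y) = \pi_(lquot B) x + \pi_(lquot B) y.
Proof. exact: (Quotient.pi_add (span_pred B)). Qed.

Definition lquot_scale (a : A) (q : lquot B) : lquot B :=
  \pi_(lquot B) (a *: repr q).

Lemma lquotZ a (x : M) :
  \pi_(lquot B) (a *: x) = lquot_scale a (\pi_(lquot B) x).
Proof.
apply/eqP; rewrite eq_sym; apply/lquot_eqP.
by rewrite -scalerBr; apply/spanZ/lquot_repr.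
Qed.

Fact lquot_scaleA a b q :
  lquot_scale a (lquot_scale b q) = lquot_scale (a * b) q.
Proof. by rewrite -[q]reprK -!lquotZ scalerA reprK. Qed.

Fact lquot_scale1 : left_id 1 lquot_scale.
Proof. by move=> q; rewrite -[q]reprK -lquotZ scale1r. Qed.

Fact lquot_scaleDr : right_distributive lquot_scale +%R.
Proof.
by move=> a p q; rewrite -[p]reprK -[q]reprK -lquotD -!lquotZ scalerDr lquotD.
Qed.

Fact lquot_scaleDl q : {morph lquot_scale^~ q : a b / a + b}.
Proof. by move=> a b; rewrite -[q]reprK -!lquotZ scalerDl lquotD. Qed.

HB.instance Definition _ := GRing.Zmodule_isLmodule.Build A (lquot B)
  lquot_scaleA lquot_scale1 lquot_scaleDr lquot_scaleDl.

End Lquot.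
End Span.

Section DirectSum.
Variables (A : pzRingType) (I : Type) (M : I -> lmodType A).

Record dsum := DSum {
  dsum_fun :> forall i, M i;
  dsum_finite : finite_set [set i | dsum_fun i <> 0] }.

Lemma dsumP (f g : dsum) : (forall i, f i = g i) -> f = g.
Proof.
case: f g => [f Hf] [g Hg] /= fg.
have E : f = g by exact: functional_extensionality_dep.
by subst g; congr DSum; apply: Prop_irrelevance.
Qed.

HB.instance Definition _ := gen_eqMixin dsum.
HB.instance Definition _ := gen_choiceMixin dsum.

Fact dsum0_finite : finite_set [set i | (0 : M i) <> 0].
Proof. by rewrite (_ : [set i | _] = set0) // -subset0 => i /=. Qed.
Definition dsum0 := DSum dsum0_finite.

Fact dsumD_finite (f g : dsum) : finite_set [set i | f i + g i <> 0].
Proof.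
have : finite_set ([set i | f i <> 0] `|` [set i | g i <> 0]).
  by rewrite finite_setU; split; apply: dsum_finite.
apply: sub_finite_set => i /= fg.
have [f0|/eqP f0] := eqVneq (f i) 0; last by left.
by right=> g0; apply: fg; rewrite f0 g0 addr0.
Qed.
Definition dsumD f g := DSum (dsumD_finite f g).

Fact dsum_map_finite (h : forall i, M i -> M i) (f : dsum) :
  (forall i, h i 0 = 0) -> finite_set [set i | h i (f i) <> 0].
Proof.
move=> h0; apply: sub_finite_set (dsum_finite f) => i /= hf f0.
by apply: hf; rewrite f0 h0.
Qed.
Definition dsum_map (h : forall i, M i -> M i) (h0 : forall i, h i 0 = 0) f :=
  DSum (dsum_map_finite f h0).

Definition dsumN := @dsum_map (fun i => -%R) (fun i => @oppr0 (M i)).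
Definition dsumZ a := @dsum_map (fun i => *:%R a) (fun i => @scaler0 A (M i) a).

Fact dsumDA : associative dsumD.
Proof. by move=> f g h; apply: dsumP => i /=; rewrite addrA. Qed.
Fact dsumDC : commutative dsumD.
Proof. by move=> f g; apply: dsumP => i /=; rewrite addrC. Qed.
Fact dsum0D : left_id dsum0 dsumD.
Proof. by move=> f; apply: dsumP => i /=; rewrite add0r. Qed.
Fact dsumND : left_inverse dsum0 dsumN dsumD.
Proof. by move=> f; apply: dsumP => i /=; rewrite addNr. Qed.

HB.instance Definition _ :=
  GRing.isZmodule.Build dsum dsumDA dsumDC dsum0D dsumND.

Fact dsumZA a b f : dsumZ a (dsumZ b f) = dsumZ (a * b) f.
Proof. by apply: dsumP => i /=; rewrite scalerA. Qed.
Fact dsumZ1 : left_id 1 dsumZ.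
Proof. by move=> f; apply: dsumP => i /=; rewrite scale1r. Qed.
Fact dsumZDr : right_distributive dsumZ +%R.
Proof. by move=> a f g; apply: dsumP => i /=; rewrite scalerDr. Qed.
Fact dsumZDl f : {morph dsumZ^~ f : a b / a + b}.
Proof. by move=> a b; apply: dsumP => i /=; rewrite scalerDl. Qed.

HB.instance Definition _ := GRing.Zmodule_isLmodule.Build A dsum
  dsumZA dsumZ1 dsumZDr dsumZDl.

Definition dsum_inj_fun (i : I) (m : M i) (j : I) : M j :=
  if pselect (i = j) is left e then ecast j (M j) e m else 0.

Fact dsum_inj_finite i (m : M i) :
  finite_set [set j | dsum_inj_fun m j <> 0].
Proof.
apply: sub_finite_set (finite_set1 i) => j /=.
by rewrite /dsum_inj_fun; case: pselect.
Qed.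
Definition dsum_inj i m := DSum (@dsum_inj_finite i m).

End DirectSum.

(** * Representations *)

Record rep (k : pzRingType) (W : groupType) := Rep {
  rep_mod :> lmodType k;
  ract : W -> rep_mod -> rep_mod;
  act_linear : forall w, linear (ract w);
  act1 : forall v, ract 1%g v = v;
  actM : forall w w' v, ract (w * w')%g v = ract w (ract w' v) }.

Arguments ract {k W V} w v : rename.

Section Reps.
Variables (k : pzRingType) (W : groupType).

Definition rep_iso (U V : rep k W) : Prop :=
  exists f : {linear U -> V},
    bijective f /\ forall w u, f (ract w u) = ract w (f u).

Definition faithful_rep (V : rep k W) : Prop :=
  forall w, (forall v : V, ract w v = v) -> w = 1%g.

Definition invariants (V : rep k W) : set V :=
  [set v | forall w, ract w v = v].
Arguments invariants : clear implicits.

Lemma act0 (V : rep k W) w : ract w (0 : V) = 0.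
Proof.
have := act_linear w 1 (0 : V) 0; rewrite !scale1r addr0 => /eqP.
by rewrite -subr_eq subrr eq_sym => /eqP.
Qed.

Definition trivial_rep (M : lmodType k) : rep k W :=
  @Rep k W M (fun=> id) (fun _ _ _ _ => erefl) (fun=> erefl)
    (fun _ _ _ => erefl).

Definition inflate (G : groupType) (f : UMagmaMorphism.type W G)
  (V : rep k G) : rep k W.
Proof.
apply: (@Rep k W V (fun w => ract (f w))) => [w|v|w w' v].
- exact: act_linear.
- by rewrite gmulf1 act1.
- by rewrite gmulfM actM.
Defined.

Definition rep_sum (U V : rep k W) : rep k W.
Proof.
apply: (@Rep k W (U * V)%type (fun w p => (ract w p.1, ract w p.2))).
- by move=> w a [u v] [u' v'] /=; rewrite !act_linear.
- by case=> u v /=; rewrite !act1.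
- by move=> w w' [u v] /=; rewrite !actM.
Defined.

Definition rep_dsum (I : Type) (V : I -> rep k W) : rep k W.
Proof.
apply: (@Rep k W (dsum V) (fun w => dsum_map (h := fun i => @ract k W (V i) w)
    (fun i => act0 (V i) w))).
- by move=> w a f g; apply: dsumP => i /=; rewrite act_linear.
- by move=> f; apply: dsumP => i /=; rewrite act1.
- by move=> w w' f; apply: dsumP => i /=; rewrite actM.
Defined.

Section QuotRep.
Variables (V : rep k W) (B : set V) (Binv : B `<=` invariants V).

Lemma act_span w (v : V) : lspan B v -> ract w v = v.
Proof.
move=> [r [c [rB ->]]]; elim: r rB => [|b r IH] rB; first by rewrite big_nil act0.
rewrite big_cons act_linear IH => [|x xr].
  by rewrite Binv //; apply: rB; rewrite mem_head.
by apply: rB; rewrite inE xr orbT.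
Qed.

Lemma actB w (u v : V) : ract w (u - v) = ract w u - ract w v.
Proof. by rewrite addrC -scaleN1r act_linear scaleN1r addrC. Qed.

Lemma quot_act_pi w (v : V) :
  \pi_(lquot B) (ract w (repr (\pi_(lquot B) v))) = \pi_(lquot B) (ract w v).
Proof.
apply/eqP/lquot_eqP; rewrite -actB act_span; exact: lquot_repr.
Qed.

Definition quot_rep : rep k W.
Proof.
apply: (@Rep k W (lquot B) (fun w q => \pi_(lquot B) (ract w (repr q)))).
- move=> w a p q /=.
  have -> : a *: p + q = \pi_(lquot B) (a *: repr p + repr q).
    by rewrite lquotD lquotZ !reprK.
  by rewrite quot_act_pi act_linear lquotD lquotZ.
- by move=> q; rewrite act1 reprK.
- by move=> w w' q; rewrite quot_act_pi actM.
Defined.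

End QuotRep.
End Reps.

Arguments invariants {k W} V.

(** * Realizations *)

(* The domain hypothesis on k is only imposed where realizations are used.
   Since S generates W, the action of W is determined by the last field. *)
Record realization (k : comNzRingType) (W : groupType) (S : set W) :=
  Realization {
  realization_rep :> rep k W;
  simple_root : S -> realization_rep;
  simple_coroot : S -> {scalar realization_rep};
  realization_free : exists B : set realization_rep, is_basis setT B;
  coroot_root : forall s, simple_coroot s (simple_root s) = 2;
  coroot_eq0 : forall s t : S, s <> t ->
    (simple_coroot s (simple_root t) = 0 <-> has_order (val s * val t)%g 2);
  act_reflection : forall (s : S) v,
    ract (val s) v = v - simple_coroot s v *: simple_root s }.

(** * Lattices, almost-orthants and transposition graphs *)

Section AlmostOrthant.
Variables (k : comNzRingType) (W : groupType).
Implicit Type V : rep k W.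

Definition zspan V (B : set V) : set V := @lspan int (zmodule V) B.
Definition zbasis V (L B : set V) : Prop := @is_basis int (zmodule V) L B.

Definition preserves_lattice V (L : set V) : Prop :=
  (exists B : set V, is_basis setT B /\ L = zspan B) /\
  (forall w v, L v -> L (ract w v)).

Definition almost_orthant V (X H : set V) : set V :=
  [set v | exists (r t : seq V) (a : V -> nat) (c : V -> int),
     [/\ forall x, x \in r -> X x, forall h, h \in t -> H h &
         v = \sum_(x <- r) x *+ a x + \sum_(h <- t) h *~ c h]].

Definition preserves_almost_orthant V (X H : set V) : Prop :=
  [/\ X `&` H = set0,
      exists L : set V, preserves_lattice L /\ zbasis L (X `|` H),
      H `<=` invariants V
    & forall w v, almost_orthant X H v -> almost_orthant X H (ract w v)].

End AlmostOrthant.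

Section Graph.
Variables (k : comNzRingType) (W : groupType) (S : set W).
Variables (V : realization k S) (X : set V).

Definition acts_nontrivially (s : S) : Prop :=
  exists v : V, ract (val s) v <> v.

Definition moved (s : S) : set V := [set x | X x /\ ract (val s) x <> x].

Definition joins (s : S) (x y : V) : Prop :=
  [/\ acts_nontrivially s, x <> y & moved s = [set x; y]].

Inductive connected_to (x : V) : V -> Prop :=
  | connected_refl : connected_to x x
  | connected_step y z s : connected_to x y -> joins s y z -> connected_to x z.

Definition component :=
  {C : set V | exists2 x, X x & C = [set y | connected_to x y]}.

Definition edges_in (C : component) : set S :=
  [set s | acts_nontrivially s /\ moved s `<=` sval C].

Definition parabolic (C : component) : set W :=
  subgroup_generated [set w | exists2 s : S, edges_in C s & w = val s].

Definition root_sum (C : component) : V := \sum_(s \in edges_in C) simple_root V s.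

End Graph.

(** * The types of components and the corresponding groups *)

(* The affine Weyl group of type A_(n-1)~, as the semidirect product of 'S_n
   with the (co)root lattice {q in Z^n : \sum_i q_i = 0}; (s, q) is the affine
   transformation y |-> s y + q, where (s y)_i = y_(s i).  As permutations are
   composed from left to right in MathComp, this is a left action. *)
Record affWeyl (n : nat) := AffWeyl {
  aw_val : 'S_n * 'rV[int]_n;
  aw_sum0 : \sum_i aw_val.2 0 i == 0 }.

HB.instance Definition _ n := [isSub of affWeyl n for @aw_val n].
HB.instance Definition _ n := [Choice of affWeyl n by <:].

Section AffWeyl.
Variable n : nat.
Implicit Types g h : affWeyl n.

Lemma sum_col_perm (R : zmodType) (s : 'S_n) (q : 'rV[R]_n) :
  \sum_i (col_perm s q) 0 i = \sum_i q 0 i.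
Proof.
by rewrite [RHS](reindex_inj (@perm_inj _ s)); apply: eq_bigr => i _; rewrite mxE.
Qed.

Fact aw_one_subproof : \sum_i ((1%g : 'S_n), (0 : 'rV[int]_n)).2 0 i == 0.
Proof. by rewrite big1 // => i _; rewrite mxE. Qed.
Definition aw_one := AffWeyl aw_one_subproof.

Fact aw_mul_subproof g h :
  \sum_i (((aw_val g).1 * (aw_val h).1)%g,
          (aw_val g).2 + col_perm (aw_val g).1 (aw_val h).2).2 0 i == 0.
Proof.
under eq_bigr do rewrite /= mxE.
by rewrite big_split /= sum_col_perm (eqP (aw_sum0 g)) (eqP (aw_sum0 h)).
Qed.
Definition aw_mul g h := AffWeyl (aw_mul_subproof g h).

Fact aw_inv_subproof g :
  \sum_i (((aw_val g).1^-1)%g,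
          - col_perm ((aw_val g).1^-1)%g (aw_val g).2).2 0 i == 0.
Proof.
under eq_bigr do rewrite /= mxE.
by rewrite sumrN sum_col_perm (eqP (aw_sum0 g)) oppr0.
Qed.
Definition aw_inv g := AffWeyl (aw_inv_subproof g).

Fact aw_mulA : associative aw_mul.
Proof.
move=> g h f; apply: val_inj => /=; congr pair; first exact: mulgA.
by rewrite raddfD /= addrA col_permM.
Qed.

Fact aw_mul1 : left_id aw_one aw_mul.
Proof.
move=> g; apply: val_inj => /=; rewrite mul1g add0r col_perm1.
by case: (aw_val g).
Qed.

Fact aw_mulr1 : right_id aw_one aw_mul.
Proof.
by move=> g; apply: val_inj => /=; rewrite mulg1 raddf0 addr0; case: (aw_val g).
Qed.

Fact aw_mulV : left_inverse aw_one aw_inv aw_mul.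
Proof. by move=> g; apply: val_inj => /=; rewrite mulVg addNr. Qed.

Fact aw_mulrV : right_inverse aw_one aw_inv aw_mul.
Proof.
move=> g; apply: val_inj => /=; rewrite mulgV raddfN /= -col_permM mulgV.
by rewrite col_perm1 subrr.
Qed.

HB.instance Definition _ := isGroup.Build (affWeyl n)
  aw_mulA aw_mul1 aw_mulr1 aw_mulV aw_mulrV.

End AffWeyl.

(* FiniteType m is a path with n = m + 1 vertices, AffineType m is a cycle with
   n = m + 2 vertices (a double edge if m = 0).  The vertex x_(i + 1) has
   index i; the edge s_i has index i - 1 in finite type (1 <= i <= n - 1), and
   index i in affine type (0 <= i <= n - 1). *)
Inductive ctype := FiniteType of nat | AffineType of nat.

Definition is_affine (t : ctype) : bool :=
  if t is AffineType _ then true else false.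

Definition nverts (t : ctype) : nat :=
  match t with FiniteType m => m.+1 | AffineType m => m.+2 end.

Definition nedges (t : ctype) : nat :=
  match t with FiniteType m => m | AffineType m => m.+2 end.

Definition edge_src (t : ctype) : 'I_(nedges t) -> 'I_(nverts t) :=
  match t with
  | FiniteType m => widen_ord (leqnSn m)
  | AffineType m => @ord_pred m.+2
  end.

Definition edge_tgt (t : ctype) : 'I_(nedges t) -> 'I_(nverts t) :=
  match t with
  | FiniteType m => lift ord0
  | AffineType m => id
  end.

Definition weyl (t : ctype) : groupType :=
  match t with
  | FiniteType m => 'S_m.+1
  | AffineType m => affWeyl m.+2
  end.

Section AffineSimpleReflections.
Variable m : nat.

(* For i = 0, this is the reflection y |-> s_theta y + theta^\vee, where theta
   is the highest root of 'S_m.+2. *)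
Definition aff_refl_val (i : 'I_m.+2) : 'S_m.+2 * 'rV[int]_m.+2 :=
  (tperm (ord_pred i) i,
   if i == ord0 then delta_mx 0 ord0 - delta_mx 0 ord_max else 0).

Fact aff_refl_subproof i : \sum_j (aff_refl_val i).2 0 j == 0.
Proof.
rewrite /aff_refl_val /=; case: (i == ord0); last by rewrite big1 // => j _; rewrite mxE.
have D (l : 'I_m.+2) : \sum_j (delta_mx 0 l : 'rV[int]_m.+2) 0 j = 1.
  rewrite (bigD1 l) //= big1 => [|j /negPf jl]; first by rewrite mxE !eqxx addr0.
  by rewrite mxE jl andbF.
by under eq_bigr do rewrite mxE [X in _ + X]mxE; rewrite big_split /= sumrN !D subrr.
Qed.

Definition aff_refl i := AffWeyl (aff_refl_subproof i).

End AffineSimpleReflections.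

Definition simple_refl (t : ctype) : 'I_(nedges t) -> weyl t :=
  match t with
  | FiniteType m => fun i => tperm (@edge_src (FiniteType m) i)
                                   (@edge_tgt (FiniteType m) i)
  | AffineType m => @aff_refl m
  end.

Section PermutationRepresentations.
Variable k : comNzRingType.

Definition perm_rep (n : nat) : rep k 'S_n.
Proof.
apply: (@Rep k _ 'rV[k]_n (fun s v => col_perm s v)).
- by move=> s a u v; rewrite linearP.
- by move=> v; rewrite col_perm1.
- by move=> s t v; rewrite col_permM.
Defined.

(* (v, z) stands for \sum_i v_i x_i + z hbar; the formulas for the action of
   the simple reflections are in the lemmas below. *)
Definition aff_act n (g : affWeyl n) (p : 'rV[k]_n * k^o) : 'rV[k]_n * k^o :=
  let: (s, q) := aw_val g in
  (col_perm s p.1, p.2 - \sum_j (q 0 j)%:~R * (col_perm s p.1) 0 j).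

Definition aff_perm_rep (n : nat) : rep k (affWeyl n).
Proof.
apply: (@Rep k _ ('rV[k]_n * k^o)%type (@aff_act n)).
- move=> g a [u y] [v z]; rewrite /aff_act; case: (aw_val g) => s q /=.
  congr pair; first by rewrite linearP.
  rewrite /= scalerBr -addrA [in RHS]addrACA -opprD addrA; congr (_ - _).
  rewrite scaler_sumr -big_split /=; apply: eq_bigr => j _.
  by rewrite !mxE mulrDr scalerAr.
- move=> [v z]; rewrite /aff_act /= col_perm1 big1 ?subr0 // => j _.
  by rewrite mxE mul0r.
- move=> g h [v z]; rewrite /aff_act /=.
  case: (aw_val g) (aw_val h) => s q [t r] /=; rewrite col_permM.
  congr pair; rewrite -addrA -opprD; congr (_ - _).
  rewrite [X in _ = X + _](reindex_inj (@perm_inj _ s)) -big_split /=.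
  by apply: eq_bigr => j _; rewrite !mxE rmorphD mulrDl addrC.
Defined.

Section AffineFormulas.
Variable m : nat.
Let P := aff_perm_rep m.+2.

Definition aff_x (i : 'I_m.+2) : P := (delta_mx 0 i, 0).
Definition aff_hbar : P := (0, 1).

Lemma act_aff_hbar g : ract g aff_hbar = aff_hbar.
Proof.
rewrite /= /aff_act; case: (aw_val g) => s q /=; rewrite raddf0 big1 ?subr0 //.
by move=> j _; rewrite mxE mulr0.
Qed.

Lemma col_perm_delta (s : 'S_m.+2) i :
  col_perm s (delta_mx 0 i : 'rV[k]_m.+2) = delta_mx 0 ((s^-1)%g i).
Proof.
by apply/rowP => j; rewrite !mxE (can2_eq (permK s) (permKV s)).
Qed.

Lemma act_aff_x (g : affWeyl m.+2) i (j := ((aw_val g).1^-1)%g i) :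
  ract g (aff_x i) = aff_x j - ((aw_val g).2 0 j)%:~R *: aff_hbar.
Proof.
rewrite /= /aff_act /j; case: (aw_val g) => s q /=; rewrite col_perm_delta.
set c := (q 0 _)%:~R; congr pair.
  by rewrite -[LHS]subr0 -(scaler0 'rV[k]_m.+2 c).
rewrite -[RHS]/(0 - c * 1) mulr1 (bigD1 ((s^-1)%g i)) //= big1.
  by rewrite mxE !eqxx mulr1 addr0.
by move=> l /negPf li; rewrite mxE li andbF mulr0.
Qed.

Lemma act_aff_refl (i j : 'I_m.+2) : i != ord0 ->
  ract (aff_refl i) (aff_x j) = aff_x (tperm (ord_pred i) i j).
Proof.
by move=> /negPf i0; rewrite act_aff_x /= i0 mxE scale0r subr0 tpermV.
Qed.

Lemma act_aff_refl0_max :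
  ract (aff_refl (ord0 : 'I_m.+2)) (aff_x ord_max) = aff_x ord0 - aff_hbar.
Proof.
rewrite act_aff_x /= tpermV; have -> : ord_pred ord0 = ord_max :> 'I_m.+2.
  by apply: val_inj; rewrite /= modn_small.
by rewrite tpermL !mxE /= subr0 scale1r.
Qed.

Lemma act_aff_refl0_0 :
  ract (aff_refl (ord0 : 'I_m.+2)) (aff_x ord0) = aff_x ord_max + aff_hbar.
Proof.
rewrite act_aff_x /= tpermV; have -> : ord_pred ord0 = ord_max :> 'I_m.+2.
  by apply: val_inj; rewrite /= modn_small.
by rewrite tpermR !mxE /= eqxx sub0r rmorphN scaleNr scale1r opprK.
Qed.

Lemma act_aff_refl0_mid j : j != ord0 -> j != ord_max ->
  ract (aff_refl (ord0 : 'I_m.+2)) (aff_x j) = aff_x j.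
Proof.
move=> j0 jm; rewrite act_aff_x /= tpermV.
have -> : ord_pred ord0 = ord_max :> 'I_m.+2.
  by apply: val_inj; rewrite /= modn_small.
by rewrite tpermD 1?eq_sym // !mxE (negPf j0) (negPf jm) !andbF subr0 scale0r subr0.
Qed.

Definition aff_root (i : 'I_m.+2) : P :=
  aff_x (ord_pred i) - aff_x i + (if i == ord0 then aff_hbar else 0).

Lemma sum_aff_root : \sum_i aff_root i = aff_hbar.
Proof.
rewrite big_split sumrB /= -big_mkcond big_pred1_eq.
by rewrite [X in _ - X](reindex_inj (@ord_pred_inj _)) subrr add0r.
Qed.

End AffineFormulas.

Definition perm_rep_of (t : ctype) : rep k (weyl t) :=
  match t with
  | FiniteType m => perm_rep m.+1
  | AffineType m => aff_perm_rep m.+2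
  end.

(* Only meaningful in affine type. *)
Definition hbar (t : ctype) : perm_rep_of t :=
  match t with
  | FiniteType m => 0
  | AffineType m => aff_hbar m
  end.

Lemma hbar_invariant t g : ract g (hbar t) = hbar t.
Proof. by case: t g => m g; [exact: act0 | exact: act_aff_hbar]. Qed.

End PermutationRepresentations.

(** * Labelled components and the decomposition *)

Record labelling (k : comNzRingType) (W : groupType) (S : set W)
    (V : realization k S) (X : set V) (C : component X) := Labelling {
  ltype :> ctype;
  vert : 'I_(nverts ltype) -> V;
  edge : 'I_(nedges ltype) -> S;
  vert_bij : set_bij setT (sval C) vert;
  edge_bij : set_bij setT (edges_in C) edge;
  edge_joins : forall i, joins X (edge i) (vert (edge_src i)) (vert (edge_tgt i)) }.

Section Decomposition.
Variables (k : comNzRingType) (W : groupType) (S : set W).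
Variables (V : realization k S) (X H : set V).
Variable L : forall C : component X, labelling C.
Variable pr : forall C, UMagmaMorphism.type W (weyl (L C)).

(* (pr C)_C identifies W with the direct product of the groups weyl (L C),
   compatibly with the labelling of the simple reflections; each factor
   weyl (L C) corresponds to W_C, and all but finitely many are trivial. *)
Definition product_decomposition : Prop :=
  [/\ forall C i, pr C (val (edge (l := L C) i)) = simple_refl i,
      forall C (s : S), ~ edges_in C s -> pr C (val s) = 1%g,
      bijective (fun (w : W) (C : component X) => pr C w),
      forall C, set_bij (parabolic C) setT (pr C)
    & finite_set [set C : component X | parabolic C <> [set 1%g]]].

(* Rescaling each simple root by a unit, and its coroot by the inverse, does not
   change the action; but root_sum C lies in the span of H only if the simple
   roots of C are scaled compatibly. *)
Definition balanced_scaling (u : S -> k) : Prop :=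
  (forall s, exists c, c * u s = 1) /\
  (forall C, is_affine (L C) ->
     zspan H (\sum_(s \in edges_in C) u s *: simple_root V s)).

Definition Zmod : lmodType k := dsum (fun _ : H => k^o).

Definition Zmod_to_span (z : Zmod) : V := \sum_(h \in [set: H]) z h *: val h.

Definition PC (C : component X) : rep k W :=
  inflate (pr C) (perm_rep_of k (L C)).

Definition ZP : rep k W := rep_sum (trivial_rep W Zmod) (rep_dsum PC).

Definition hbarC (C : component X) : rep_dsum PC :=
  dsum_inj (M := PC) (hbar k (L C) : PC C).

Variable v : component X -> Zmod.

Definition Kgen : set ZP :=
  [set m | exists2 C, is_affine (L C) & m = (- v C, hbarC C)].

Lemma Kgen_invariant : Kgen `<=` invariants ZP.
Proof.
move=> _ [C _ ->] w; congr pair; apply: dsumP => D /=.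
rewrite /dsum_inj_fun; case: pselect => [e|_]; last exact: act0.
by case: _ / e; apply: hbar_invariant.
Qed.

Definition ZP_mod_K : rep k W := quot_rep Kgen_invariant.

End Decomposition.

(* Main.v *)
Require Import Defs.
From HB Require Import structures.
From mathcomp Require Import all_boot all_order all_algebra all_fingroup.
From mathcomp Require Import ring_quotient generic_quotient.
From mathcomp Require Import all_classical all_reals.
From mathcomp Require Import ring zify.
(* fingroup shadows ract, act1 and actM. *)
Import Defs.

Set Implicit Arguments.
Unset Strict Implicit.
Unset Printing Implicit Defensive.

Import Order.TTheory GRing.Theory Num.Theory.

Local Open Scope classical_set_scope.
Local Open Scope ring_scope.

(* Let q_z be the coordinates of alpha_s at z in X, and p_z = alpha_s^vee(z).
   The orthant being preserved, every p_x q_z is an integer and is at most 0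
   (x <> z) or 1 (x = z), while sum_x p_x q_x = 2.  So there are exactly two
   elements x, y with p_x q_x = p_y q_y = 1, all the other coordinates of
   alpha_s and of its coroot vanish, and a unit multiple of alpha_s has the form
   x - y - h with h in Span_Z H.  The order of st is then 2, 3 or infinite
   according as the edges of s and t share 0, 1 or 2 vertices.

   By faithfulness, three edges at a common vertex would satisfy in W a relation
   that holds for transpositions and translations but not in the Tits
   representation of a Coxeter group with these orders.  So every vertex has
   degree at most 2, and every component is a path or a cycle.

   On a component C, sliding the vertices along the edges gives a normalized
   basis, hence a map phi_C : P_C -> V commuting with the simple reflections.
   The orders above also make the projections W -> W_C well defined, and phi_C
   is equivariant; as the images of the phi_C and H span V, faithfulness makes
   the product of the projections injective.  Finally, if the sum of the simple
   roots of an affine component lies in Span H, then these roots are all scaled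
   by the same unit, and rescaling phi_C by it yields the isomorphism. *)

(** * Bases and coordinates *)

Section LinearExtension.
Variables (A : pzRingType) (M : lmodType A).

(** Changing the signs of three roots alters neither their reflections nor the product of their
    three mutual pairings. For three edges at a vertex y, with roots pointing away from y, the
    pairings in V are 1 or 2 and the product is positive; in the Tits form they are -1 or -2 and the
    product is negative. This sign is what rules out degree 3. It takes three shapes: the far
    endpoints are all distinct, exactly two of them coincide, or all three do.

    W is an abstract group. An identity between its elements is therefore proved in V, by
    faithfulness, and refuted by a homomorphism out of W, which only the Coxeter presentation can
    supply.

    The terms in Span H are invisible to the coordinates at X, hence to every pairing. They come
    back as translations: they give the product of two parallel edges its infinite order, and their
    total around a cycle is, up to sign, the image of ħ. *)

Lemma lspan_uniq (B : set M) v : lspan B v ->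
  exists (r : seq M) (c : M -> A),
    [/\ uniq r, forall b, b \in r -> B b & v = \sum_(b <- r) c b *: b].
Proof.
case=> r [c [rB ->]].
exists (undup r), (fun b => c b *+ count_mem b r); split.
- exact: undup_uniq.
- by move=> b; rewrite mem_undup; apply: rB.
rewrite -big_undup_iterop_count; apply: eq_bigr => b _.
by rewrite -scalerMnl.
Qed.

Lemma lspan_ind (B : set M) (P : M -> Prop) :
    (forall b, B b -> P b) ->
    (forall a u v, P u -> P v -> P (a *: u + v)) -> P 0 ->
  forall v, lspan B v -> P v.
Proof.
move=> PB PD P0 v [r [c [rB ->]]]; elim: r rB => [|b r IH] rB.
  by rewrite big_nil.
rewrite big_cons; apply: PD; first by apply/PB/rB; rewrite mem_head.
by apply: IH => x xr; apply: rB; rewrite inE xr orbT.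
Qed.

Lemma lspanL (B : set M) a u v :
  lspan B u -> lspan B v -> lspan B (a *: u + v).
Proof. by move=> Bu Bv; apply: spanD => //; apply: spanZ. Qed.

Lemma lspan_sum (B : set M) (I : Type) (r : seq I) (P : pred I) (F : I -> M) :
  (forall i, P i -> lspan B (F i)) -> lspan B (\sum_(i <- r | P i) F i).
Proof.
move=> FB; apply: (big_ind (lspan B)) => //; first exact: span0.
by move=> x y; apply: spanD.
Qed.

Lemma lspanN (B : set M) v : lspan B v -> lspan B (- v).
Proof. by rewrite -scaleN1r; apply: spanZ. Qed.

End LinearExtension.

Section Extension.
Variables (A : pzRingType) (M N : lmodType A) (B : set M) (g : M -> N).
Hypothesis Bfree : lin_indep B.

(* The graph of the extension is the span of the graph of g on B. *)
Let gr : set (M * N)%type := lspan [set p | B p.1 /\ p.2 = g p.1].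

Let gr_fun v w w' : gr (v, w) -> gr (v, w') -> w = w'.
Proof.
move=> h h'; apply/eqP; rewrite -subr_eq0; apply/eqP.
have : gr (0, w - w').
  have -> : (0, w - w') = (v, w) + - (v, w') :> (M * N)%type.
    by congr pair; rewrite /= subrr.
  by apply: spanD => //; apply: lspanN.
move=> /lspan_uniq [r [c [ru rB e]]].
have e1 : \sum_(p <- r) c p *: p.1 = 0.
  by move/(congr1 fst): e; rewrite raddf_sum.
have e2 : w - w' = \sum_(p <- r) c p *: p.2.
  by move/(congr1 snd): e; rewrite raddf_sum.
have inj : {in r &, injective fst}.
  by move=> [a b] [a' b'] /rB[/= _ ->] /rB[/= _ ->] /= ->.
have := Bfree (r := map fst r) (c := fun b => c (b, g b)).
rewrite map_inj_in_uniq // big_map => /(_ ru) free.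
have {}free : forall b, b \in map fst r -> c (b, g b) = 0.
  apply: free => [_ /mapP[p /rB[Bp _] ->] //|].
  rewrite -[RHS]e1 [LHS]big_seq [RHS]big_seq; apply: eq_bigr => p /rB[_ pE].
  by rewrite -pE -surjective_pairing.
rewrite e2 big_seq big1 // => p pr.
have [_ pE] := rB p pr.
by rewrite [p]surjective_pairing pE free ?scale0r //; apply: map_f.
Qed.

Let gr_tot v : exists w, lspan B v -> gr (v, w).
Proof.
apply/not_existsP => nw; have [Bv|] := pselect (lspan B v); last first.
  by move=> nBv; apply: (nw 0).
suff [w vw] : exists w, gr (v, w) by apply: (nw w).
move: v Bv {nw}; apply: lspan_ind => [b Bb|a u v [w uw] [w' vw']|].
- by exists (g b); apply: span_inc.
- by exists (a *: w + w'); apply: (@lspanL _ _ _ a (u, w) (v, w')).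
- by exists 0; apply: span0.
Qed.

(** Linearity is claimed on the span only, since B need not generate M: one use is for a ℤ-basis of
    a lattice inside V, seen as a ℤ-module. Outside the span the values come from an arbitrary
    choice. *)
Lemma lin_ext : exists f : M -> N, (forall b, B b -> f b = g b) /\
  (forall a u v, lspan B u -> lspan B v -> f (a *: u + v) = a *: f u + f v).
Proof.
have [f fP] := choice gr_tot; exists f; split=> [b Bb|a u v Bu Bv].
  by apply: (@gr_fun b); [apply/fP/span_inc | apply: span_inc].
apply: (@gr_fun (a *: u + v)); first exact/fP/lspanL.
exact: (@lspanL _ _ _ a (u, f u) (v, f v)) (fP _ Bu) (fP _ Bv).
Qed.

End Extension.

Lemma basis_ext (A : pzRingType) (M N : lmodType A) (B : set M) (g : M -> N) :
  is_basis setT B -> exists f : {linear M -> N}, forall b, B b -> f b = g b.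
Proof.
case=> Bfree BT; have [f [fB fL]] := lin_ext g Bfree.
have flin : linear f by move=> a u v; apply: fL; rewrite BT.
exact: (ex_intro _ (HB.pack_for {linear M -> N} f
  (GRing.isLinear.Build _ _ _ _ f flin)) fB).
Qed.

Section Coordinates.
Variables (k : comNzRingType) (W : groupType) (V : rep k W).

Lemma zspan_lspan (B : set V) v : zspan B v -> lspan B v.
Proof.
apply: lspan_ind => [b|a u w Bu Bw|]; [exact: span_inc | | exact: span0].
by rewrite [a *: _]scalezrE -scaler_int; apply: lspanL.
Qed.

(* A k-basis and a Z-basis of the same lattice have mutually inverse integral
   transition matrices, so the Z-basis is a k-basis as well. *)
Lemma zbasis_coord (B Y L : set V) : is_basis setT B -> L = zspan B ->
  zbasis L Y -> exists xi : V -> {scalar V},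
    forall b b', Y b -> Y b' -> xi b b' = (b == b')%:R.
Proof.
move=> Bb LB [Yfree YL].
suff H b : exists f : {scalar V}, forall b', Y b' -> f b' = (b == b')%:R.
  by have [xi xiP] := choice H; exists xi => b b' _; apply: xiP.
(* [z] is the integral coordinate at b on the lattice. The k-linear form [f] takes the same values
   on B, hence agrees with [z] on all of L, and in particular on Y. *)
have [z [zY zL]] := @lin_ext int (zmodule V) int^o Y (fun b' : V => (b == b')%:R) Yfree.
have [f fB] := @basis_ext k V k^o B (fun b' => (z b')%:~R) Bb.
exists f => b' Yb'.
have zB v : L v -> f v = (z v)%:~R.
  rewrite {1}LB => Bv.
  pose P (v : zmodule V) := f (v : V) = (z v)%:~R /\ zspan Y v.
  suff [//] : P v.
  apply: (lspan_ind (P := P)) Bv => [c Bc|a u w [fu Yu] [fw Yw]|].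
  - split; first exact: fB.
    by change (zspan Y c); rewrite /zspan YL LB; apply: span_inc.
  - split; last exact: lspanL.
    rewrite zL // scalezrE.
    change (f ((u : V) *~ a + w) = (a * z u + z w)%:~R).
    rewrite raddfD raddfMz /= rmorphD rmorphM /=.
    by rewrite [f u]fu [f w]fw mulrzl.
  - split; last exact: span0.
    rewrite raddf0; have := zL (-1) 0 0 (span0 _) (span0 _).
    by rewrite !scaleN1r !addNr => ->.
rewrite zB; first by rewrite zY //; case: (b == b').
by rewrite -YL; apply: span_inc.
Qed.

Lemma zbasis_span (B Y L : set V) : is_basis setT B -> L = zspan B ->
  zbasis L Y -> forall v, lspan Y v.
Proof.
move=> [_ BT] LB [_ YL] v; have: lspan B v by rewrite BT.
apply: lspan_ind; [|by move=> a u w; apply: lspanL|exact: span0] => b Bb.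
by apply: zspan_lspan; rewrite /zspan YL LB; apply: span_inc.
Qed.

End Coordinates.

(** * Simple reflections as edges *)

(** A positive sum of integers at most 1 has a term equal to 1; deleting that term leaves the sum 1,
    which is again positive. *)
Lemma two_ones (I : eqType) (r : seq I) (n : I -> int) :
    uniq r -> {in r, forall b, n b <= 1} -> \sum_(b <- r) n b = 2 ->
  exists x y, [/\ x \in r, y \in r, x != y, n x = 1 & n y = 1].
Proof.
have one (s : seq I) : {in s, forall b, n b <= 1} ->
    0 < \sum_(b <- s) n b -> exists2 b, b \in s & n b = 1.
  elim: s => [|b s IH] ns; first by rewrite big_nil.
  rewrite big_cons => sum_gt0; have nb := ns b (mem_head _ _).
  have [n1|nb1] := eqVneq (n b) 1; first by exists b; rewrite ?mem_head.
  have [||c cs nc] := IH _ _.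
  - by move=> c cs; apply: ns; rewrite inE cs orbT.
  - by move: sum_gt0 nb nb1; move: (n b) (\sum_(j <- s) n j) => a c; lia.
  by exists c; rewrite // inE cs orbT.
move=> ru n1 sum2; have [|x xr nx] := one r n1; first by rewrite sum2.
move: sum2; rewrite (bigD1_seq x) //= nx -big_filter => sum1.
have [||y] := one [seq y <- r | y != x].
- by move=> b; rewrite mem_filter => /andP[_ /n1].
- by rewrite -(ltrD2l 1) sum1.
by rewrite mem_filter eq_sym => /andP[xy yr] ny; exists x, y.
Qed.

Lemma scalarZ (k : comNzRingType) (V : lmodType k) (f : {scalar V}) a v :
  f (a *: v) = a * f v.
Proof. exact: linearZ. Qed.

Section Edges.
Variables (k : comNzRingType) (W : groupType) (S : set W).
Variables (V : realization k S) (X H : set V).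
Variable xi : V -> {scalar V}.

(** The lattice is replaced by the coordinate forms [xi b] of the basis X ∪ H. Equations in k
    between integers are read in ℤ through [int_inj]. *)
Record orthant_coords : Prop := OrthantCoords {
  int_inj : injective (fun z : int => z%:~R : k);
  XH0 : X `&` H = set0;
  Hinv : H `<=` invariants V;
  ortho : forall w v, almost_orthant X H v -> almost_orthant X H (ract w v);
  xiE : forall b b', (X `|` H) b -> (X `|` H) b' -> xi b b' = (b == b')%:R;
  spanXH : forall v : V, lspan (X `|` H) v }.

Hypothesis D : orthant_coords.

Lemma basis_decomp v : exists r : seq V,
  [/\ uniq r, forall b, b \in r -> (X `|` H) b & v = \sum_(b <- r) xi b v *: b].
Proof.
have [r [c [ru rB vE]]] := lspan_uniq (spanXH D v); exists r; split=> //.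
rewrite {1}vE [LHS]big_seq [RHS]big_seq; apply: eq_bigr => b br.
congr (_ *: _); rewrite vE raddf_sum (bigD1_seq b) //= scalarZ.
rewrite (xiE D (rB _ br) (rB _ br)) eqxx mulr1.
rewrite big_seq_cond big1 ?addr0 // => b' /andP[b'r bb'].
rewrite scalarZ (xiE D); [|exact: rB|exact: rB].
by rewrite eq_sym (negPf bb') mulr0.
Qed.

Lemma coord_eq u v : (forall b, (X `|` H) b -> xi b u = xi b v) -> u = v.
Proof.
move=> uv; apply/eqP; rewrite -subr_eq0; apply/eqP.
have [r [_ rB ->]] := basis_decomp (u - v).
by rewrite big_seq big1 // => b /rB bB; rewrite raddfB /= uv // subrr scale0r.
Qed.

Lemma xi_XH x h : X x -> H h -> xi x h = 0.
Proof.
move=> Xx Hh; rewrite (xiE D); [|by left|by right].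
case: eqP => // xh; have : set0 x by rewrite -(XH0 D); split=> //; rewrite xh.
by [].
Qed.

Lemma xi_HX h x : H h -> X x -> xi h x = 0.
Proof.
move=> Hh Xx; rewrite (xiE D); [|by right|by left].
case: eqP => // xh; have : set0 x by rewrite -(XH0 D); split=> //; rewrite -xh.
by [].
Qed.

Lemma xi_X x y : X x -> X y -> xi x y = (x == y)%:R.
Proof. by move=> Xx Xy; apply: (xiE D); left. Qed.

Lemma zspanH_lspan v : zspan H v -> lspan H v.
Proof. exact: zspan_lspan. Qed.

Lemma xi_lspanH x v : X x -> lspan H v -> xi x v = 0.
Proof.
move=> Xx; apply: (lspan_ind (P := fun v => xi x v = 0)) => [b|a u w xu xw|].
- exact: xi_XH.
- by rewrite linearP /= xu xw mulr0 addr0.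
- exact: raddf0.
Qed.

Lemma xi_spanH x v : X x -> zspan H v -> xi x v = 0.
Proof. by move=> Xx /zspanH_lspan; apply: xi_lspanH. Qed.

Lemma act_spanH w v : zspan H v -> ract w v = v.
Proof. by move/zspanH_lspan; apply: act_span; exact: (Hinv D). Qed.

Lemma act_orthant w x : X x -> exists m h, [/\ ract w x = m + h,
  forall z, X z -> exists n : nat, xi z m = n%:R,
  forall z, H z -> xi z m = 0 & zspan H h].
Proof.
move=> Xx.
have : almost_orthant X H x.
  exists [:: x], [::], (fun=> 1%N), (fun=> 0); split=> //.
    by move=> z /[!inE] /eqP ->.
  by rewrite big_seq1 big_nil addr0.
move/((ortho D) w) => [r [t [a [c [rX tH ->]]]]].
exists (\sum_(x <- r) x *+ a x), (\sum_(h <- t) h *~ c h); split=> //.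
- move=> z Xz; exists (\sum_(x <- r) (z == x) * a x)%N.
  rewrite raddf_sum natr_sum big_seq [RHS]big_seq; apply: eq_bigr => y yr.
  by rewrite /= raddfMn /= xi_X ?natrM ?mulr_natr //; apply: rX.
- move=> z Hz; rewrite raddf_sum big_seq big1 // => y yr.
  by rewrite /= raddfMn /= xi_HX ?mul0rn //; apply: rX.
- by exists t, c; split.
Qed.

(* x - y - h is a multiple of the simple root, and s maps x to y + h: the pair
   {x, y} is only swapped up to h. *)
Definition edge_at (s : S) x y h :=
  [/\ X x, X y, x <> y, zspan H h &
      forall v, ract (val s) v = v - (xi x v - xi y v) *: (x - y - h)].

Lemma edge_exists s : exists x y h, edge_at s x y h.
Proof.
set al := simple_root V s; set p := simple_coroot V s.
pose q z := xi z al.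
have sE v : p v *: al = v - ract (val s) v.
  by rewrite act_reflection opprB addrC subrK.
(* p x * q z is the z-coordinate of x - s(x), and the z-coordinate of s(x) is a natural number. *)
have pq x z : X x -> X z -> exists n : nat, p x * q z = (z == x)%:R - n%:R.
  move=> Xx Xz; have [m [h [sx mX _ hH]]] := act_orthant (val s) Xx.
  have [n mn] := mX z Xz; exists n.
  rewrite -[p x * q z]/(p x * xi z al) -scalarZ sE raddfB /= sx raddfD /= mn.
  by rewrite (xi_spanH Xz hH) addr0 xi_X.
have pH b : H b -> p b *: al = 0.
  by move=> Hb; rewrite sE (Hinv D Hb) subrr.
have [r [ru rB alE]] := basis_decomp al.
have nE b : exists n : int, b \in r ->
    [/\ p b * q b = n%:~R, n <= 1 & H b -> n = 0].
  have [/rB[Xb|Hb]|_] := boolP (b \in r); last by exists 0.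
    have [n nP] := pq b b Xb Xb; exists (1 - n%:Z) => _; split.
    - by rewrite nP eqxx rmorphB.
    - by lia.
    - by move=> Hb; have : set0 b by rewrite -(XH0 D).
  exists 0 => _; split=> //.
  by rewrite -[p b * q b]/(p b * xi b al) -scalarZ pH // raddf0.
have [n nP] := choice nE.
have sum2 : \sum_(b <- r) n b = 2.
  apply: (int_inj D); rewrite raddf_sum /= -[RHS](coroot_root V s) -/p -/al {1}alE.
  rewrite raddf_sum big_seq [RHS]big_seq; apply: eq_bigr => b br.
  by rewrite /= scalarZ mulrC; have [<-] := nP b br.
have n1 : {in r, forall b, n b <= 1} by move=> b /nP[].
have [x [y [xr yr xy nx ny]]] := two_ones ru n1 sum2.
have inX b : b \in r -> n b = 1 -> X b.
  move=> br nb; case: (rB b br) => // Hb.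
  by have [_ _ /(_ Hb)] := nP b br; rewrite nb.
have Xx := inX x xr nx; have Xy := inX y yr ny.
have pqx : p x * q x = 1 by have [-> _ _] := nP x xr; rewrite nx.
have pqy : p y * q y = 1 by have [-> _ _] := nP y yr; rewrite ny.
have [a aE] := pq x y Xx Xy; have [b bE] := pq y x Xy Xx.
rewrite eq_sym (negPf xy) sub0r in aE; rewrite (negPf xy) sub0r in bE.
(* The matrix p q has rank one, so its two off-diagonal entries -a and -b at x, y have the same
   product as the diagonal ones, which are both 1. *)
have ab : (a * b)%N = 1%N.
  have : (a * b)%:Z%:~R = 1%:Z%:~R :> k.
    rewrite PoszM rmorphM -[RHS]/1 -[RHS]mulr1 -{1}pqx -{1}pqy.
    rewrite -mulrNN; transitivity ((p x * q y) * (p y * q x)).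
      by rewrite aE bE.
    by ring.
  by move/(int_inj D); case.
have [a1 b1] : a = 1%N /\ b = 1%N.
  by move/eqP: ab; rewrite muln_eq1 => /andP[/eqP -> /eqP ->].
rewrite {}a1 {}b1 {ab} in aE bE.
have qy : q y = - q x.
  by rewrite -[LHS]mul1r -pqx mulrC mulrA [q y * _]mulrC aE mulN1r.
have py : p y = - p x.
  by rewrite -[LHS]mulr1 -pqx mulrCA bE mulrN1.
(* As q y = - q x, the numbers p z * q x and p z * q y are opposite; neither is positive, so both
   vanish, and q x is a unit. *)
have pz z : X z -> z != x -> z != y -> p z = 0.
  move=> Xz zx zy; have [c cE] := pq z x Xz Xx; have [d dE] := pq z y Xz Xy.
  rewrite eq_sym (negPf zx) sub0r in cE.
  rewrite eq_sym (negPf zy) sub0r qy mulrN cE opprK in dE.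
  have c0 : c = 0%N.
    have : c%:Z%:~R = (- d%:Z)%:~R :> k by rewrite rmorphN.
    by move/(int_inj D); lia.
  by rewrite -[LHS]mulr1 -pqx mulrCA cE c0 oppr0 mulr0.
have qz z : X z -> z != x -> z != y -> q z = 0.
  move=> Xz zx zy; have [c cE] := pq x z Xx Xz; have [d dE] := pq y z Xy Xz.
  rewrite (negPf zx) sub0r in cE.
  rewrite (negPf zy) sub0r py mulNr cE opprK in dE.
  have c0 : c = 0%N.
    have : c%:Z%:~R = (- d%:Z)%:~R :> k by rewrite rmorphN.
    by move/(int_inj D); lia.
  by rewrite -[LHS]mul1r -pqx mulrAC cE c0 oppr0 mul0r.
(* All X-coordinates of s(x) are now known, so its X-part is y; the rest is the required h, and p x
   *: al = x - s(x). *)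
have [m [h [sx _ mH hH]]] := act_orthant (val s) Xx.
have mE : m = y.
  apply: coord_eq => z [Xz|Hz]; last by rewrite mH ?xi_HX.
  have -> : xi z m = xi z (ract (val s) x) by rewrite sx raddfD /= (xi_spanH Xz hH) addr0.
  have -> : ract (val s) x = x - p x *: al by rewrite sE opprB addrC subrK.
  rewrite raddfB /= scalarZ -/(q z) !xi_X //.
  have [->|zx] := eqVneq z x; first by rewrite pqx subrr (negPf xy).
  have [->|zy] := eqVneq z y; first by rewrite aE opprK add0r.
  by rewrite qz // mulr0 subr0.
exists x, y, h; split=> // [|v]; first exact/eqP.
have -> : x - y - h = p x *: al by rewrite sE sx mE opprD addrA.
rewrite -[LHS](subKr v) -sE; congr (_ - _).
apply: (lspan_ind (P := fun v => p v *: al = (xi x v - xi y v) *: (p x *: al)))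
  (spanXH D v) => [d [Xd|Hd]|c u w eu ew|].
- rewrite !xi_X // scalerA; congr (_ *: _).
  have [<-|dx] := eqVneq x d; first by rewrite eq_sym (negPf xy) subr0 mul1r.
  have [<-|dy] := eqVneq y d; first by rewrite py sub0r mulN1r.
  rewrite eq_sym in dx; rewrite eq_sym in dy.
  by rewrite pz // subrr mul0r.
- by rewrite pH // !xi_XH // subrr scale0r.
- rewrite raddfD /= !scalarZ scalerDl -scalerA eu ew !raddfD /= !scalarZ.
  by rewrite scalerA -scalerDl; congr (_ *: _); ring.
- by rewrite !raddf0 addr0 !scale0r.
Qed.

Lemma edge_sym s x y h : edge_at s x y h -> edge_at s y x (- h).
Proof.
move=> [Xx Xy xy hH sE]; split=> //; [by move/esym | exact: lspanN|].
move=> v; rewrite sE; congr (_ - _).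
by rewrite -opprB scaleNr -scalerN !opprD !opprK [- x + y]addrC.
Qed.

Lemma edge_l s x y h : edge_at s x y h -> ract (val s) x = y + h.
Proof.
move=> [Xx Xy /eqP xy hH sE]; rewrite sE !xi_X // eqxx eq_sym (negPf xy) subr0.
by rewrite scale1r -addrA opprD addrA subrr sub0r opprD !opprK.
Qed.

Lemma edge_r s x y h : edge_at s x y h -> ract (val s) y = x - h.
Proof. by move/edge_sym/edge_l. Qed.

Lemma edge_fix s x y h z : edge_at s x y h -> X z -> z <> x -> z <> y ->
  ract (val s) z = z.
Proof.
move=> [Xx Xy xy hH sE] Xz /eqP zx /eqP zy; rewrite sE !xi_X //.
by rewrite eq_sym (negPf zx) eq_sym (negPf zy) subrr scale0r subr0.
Qed.

Lemma edge_moved s x y h : edge_at s x y h -> moved X s = [set x; y].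
Proof.
move=> e; have [Xx Xy /eqP xy hH sE] := e; apply/seteqP; split=> z /=.
  move=> [Xz sz]; have [->|/eqP zx] := eqVneq z x; first by left.
  have [->|/eqP zy] := eqVneq z y; first by right.
  by case: sz; apply: (edge_fix e).
have ne u v g : X u -> X v -> u != v -> zspan H g -> v + g <> u.
  move=> Xu Xv uv gH /(congr1 (xi u)); rewrite raddfD /= (xi_spanH Xu gH) addr0.
  by rewrite !xi_X // eqxx (negPf uv) => /esym/eqP; rewrite oner_eq0.
case=> ->; split=> //; first by rewrite (edge_l e); apply: ne.
by rewrite (edge_r e); apply: ne; rewrite 1?eq_sym //; apply: lspanN.
Qed.

Lemma edge_joins_xy s x y h : edge_at s x y h -> joins X s x y.
Proof.
move=> e; have [_ _ xy _ _] := e; split=> //; last exact: edge_moved e.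
exists x; suff [] : moved X s x by [].
by rewrite (edge_moved e); left.
Qed.

Lemma set2_inj (T : Type) (x y x' y' : T) : [set x; y] = [set x'; y'] ->
  x <> y -> (x = x' /\ y = y') \/ (x = y' /\ y = x').
Proof.
move=> E xy.
have hx : [set x'; y'] x by rewrite -E; left.
have hy : [set x'; y'] y by rewrite -E; right.
by case: hx hy => /= xE [] /= yE; [case: xy|left|right|case: xy]; rewrite ?xE ?yE.
Qed.

Lemma joins_edge s x y : joins X s x y -> exists h, edge_at s x y h.
Proof.
move=> [_ xy m]; have [x' [y' [h e]]] := edge_exists s.
rewrite (edge_moved e) in m.
have [[-> ->]|[-> ->]] := set2_inj (esym m) xy.
  by exists h.
by exists (- h); apply: edge_sym.
Qed.

(** The x-coordinate of the simple root is the unit by which it differs from x - y - h, with inverse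
    the value of the coroot at x. *)
Lemma edge_root s x y h : edge_at s x y h ->
  simple_coroot V s x * xi x (simple_root V s) = 1 /\
  simple_root V s = xi x (simple_root V s) *: (x - y - h).
Proof.
move=> e; have [Xx Xy /eqP xy hH sE] := e.
have cE : simple_coroot V s x *: simple_root V s = x - y - h.
  transitivity (x - ract (val s) x).
    by rewrite act_reflection opprB addrC subrK.
  by rewrite (edge_l e) opprD addrA.
have u : simple_coroot V s x * xi x (simple_root V s) = 1.
  rewrite -scalarZ cE !raddfB /= (xi_spanH Xx hH) !xi_X // eqxx (negPf xy).
  by rewrite !subr0.
by split=> //; rewrite -cE scalerA mulrC u scale1r.
Qed.

Lemma edge_coroot s x y h v : edge_at s x y h ->
  simple_coroot V s v = simple_coroot V s x * (xi x v - xi y v).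
Proof.
move=> e; have [u _] := edge_root e; have [Xx Xy /eqP xy hH sE] := e.
have E : simple_coroot V s v *: simple_root V s = (xi x v - xi y v) *: (x - y - h).
  transitivity (v - ract (val s) v).
    by rewrite act_reflection opprB addrC subrK.
  by rewrite sE opprB addrC subrK.
move/(congr1 (xi x)): E; rewrite !scalarZ !raddfB /= (xi_spanH Xx hH).
rewrite (xi_X Xx Xx) (xi_X Xx Xy) eqxx (negPf xy) !subr0 mulr1 => <-.
by rewrite mulrCA u mulr1.
Qed.

End Edges.

(** * Orders of products of simple reflections *)

Section Reflections.
Variables (k : comNzRingType) (M : lmodType k).

(** On vectors of the form v - x a - y b - z c a reflection changes a single coefficient. Relations
    between words in reflections thus become identities in k, within reach of [ring]. *)
Lemma refl_step (f : {scalar M}) (a b c v : M) (x y z : k) :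
  let w := v - x *: a - y *: b - z *: c in
  w - f w *: a =
  v - (x + (f v - x * f a - y * f b - z * f c)) *: a - y *: b - z *: c.
Proof.
move=> w; have -> : f w = f v - x * f a - y * f b - z * f c.
  by rewrite !raddfB /= !scalarZ.
move: (_ - z * f c) => p.
have -> : v - (x + p) *: a = v - x *: a - p *: a.
  by rewrite scalerDl opprD addrA.
by rewrite /w addrAC; congr (_ - _); rewrite addrAC.
Qed.

Lemma sub0scale (a b c v : M) : v = v - (0 : k) *: a - (0 : k) *: b - (0 : k) *: c.
Proof. by rewrite !scale0r !subr0. Qed.

Variables (f g : {scalar M}) (a b : M) (s t : M -> M).
Hypothesis sE : forall v, s v = v - f v *: a.
Hypothesis tE : forall v, t v = v - g v *: b.

Let s_step c v x y z : s (v - x *: a - y *: b - z *: c) =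
  v - (x + (f v - x * f a - y * f b - z * f c)) *: a - y *: b - z *: c.
Proof. by rewrite sE refl_step. Qed.

Let t_step c v x y z : t (v - x *: a - y *: b - z *: c) =
  v - x *: a - (y + (g v - y * g b - x * g a - z * g c)) *: b - z *: c.
Proof.
rewrite tE; have -> : v - x *: a - y *: b = v - y *: b - x *: a by rewrite addrAC.
by rewrite refl_step; congr (_ - _); rewrite addrAC.
Qed.

Lemma refl_sq v : f a = 2 -> s (s v) = v.
Proof.
move=> fa; rewrite !sE raddfB /= scalarZ fa -addrA -opprD -scalerDl.
have -> : f v + (f v - f v * 2) = 0 by ring.
by rewrite scale0r subr0.
Qed.

Lemma refl_commute v : f b = 0 -> g a = 0 -> s (t v) = t (s v).
Proof.
move=> fb ga; rewrite {1}(sub0scale a b 0 v) [v in RHS](sub0scale a b 0 v)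
  !(s_step, t_step) fb ga.
by congr (_ - _ *: _ - _ *: _ - _ *: _); ring.
Qed.

(** Only the square of the pairing is prescribed, because reversing one edge changes its sign. *)
Lemma refl_braid v : f a = 2 -> g b = 2 -> f b = g a -> f b * f b = 1 ->
  s (t (s v)) = t (s (t v)).
Proof.
move=> fa gb fg ff; rewrite {1}(sub0scale a b 0 v) [v in RHS](sub0scale a b 0 v)
  !(s_step, t_step).
rewrite -fg fa gb.
congr (_ - _ *: _ - _ *: _ - _ *: _).
  transitivity (f v * (f b * f b) - f b * g v); last by rewrite ff; ring.
  by ring.
transitivity (g v * (f b * f b) - f b * f v); first by rewrite ff; ring.
by ring.
Qed.

Variables (h : {scalar M}) (c : M) (u : M -> M).
Hypothesis uE : forall v, u v = v - h v *: c.

Let u_step v x y z : u (v - x *: a - y *: b - z *: c) =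
  v - x *: a - y *: b - (z + (h v - z * h c - y * h b - x * h a)) *: c.
Proof.
have E (r q l : k) : v - r *: a - q *: b - l *: c = v - l *: c - q *: b - r *: a.
  by rewrite [LHS](ACl (1*4*3*2)).
by rewrite uE E refl_step E.
Qed.

(* The linear parts of three transpositions (y a), (y b), (y c) satisfy this
   relation of S_4. *)
Lemma refl_star v : [/\ f a = 2, g b = 2 & h c = 2] ->
    [/\ f b = 1, f c = 1 & g a = 1] -> [/\ g c = 1, h a = 1 & h b = 1] ->
  s (t (u (t v))) = t (u (t (s v))).
Proof.
move=> [fa gb hc] [fb fc ga] [gc ha hb].
rewrite {1}(sub0scale a b c v) [v in RHS](sub0scale a b c v)
  !(s_step, t_step, u_step).
rewrite fa gb hc fb fc ga gc ha hb.
by congr (_ - _ *: _ - _ *: _ - _ *: _); ring.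
Qed.

(** This is the braid relation between t and σ = u s u. The root of σ is a + c, whose pairing with t
    is 2 - 1 = 1: if s and t both swap y with y' while u swaps y with y'', then up to Span H σ swaps
    y' with y'', and it shares y' with t. *)
Lemma refl_lasso v : [/\ f a = 2, g b = 2 & h c = 2] ->
    [/\ f b = 2, f c = -1 & g a = 2] -> [/\ g c = -1, h a = -1 & h b = -1] ->
  u (s (u (t (u (s (u v)))))) = t (u (s (u (t v)))).
Proof.
move=> [fa gb hc] [fb fc ga] [gc ha hb].
rewrite {1}(sub0scale a b c v) [v in RHS](sub0scale a b c v)
  !(s_step, t_step, u_step).
rewrite fa gb hc fb fc ga gc ha hb.
by congr (_ - _ *: _ - _ *: _ - _ *: _); ring.
Qed.

(* Three reflections in parallel hyperplanes compose to a reflection. *)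
Lemma refl_parallel v : [/\ f a = 2, g b = 2 & h c = 2] ->
    [/\ f b = 2, f c = 2 & g a = 2] -> [/\ g c = 2, h a = 2 & h b = 2] ->
  f v = g v -> f v = h v -> t (s (u v)) = u (s (t v)).
Proof.
move=> [fa gb hc] [fb fc ga] [gc ha hb] fg fh.
rewrite {1}(sub0scale a b c v) [v in RHS](sub0scale a b c v)
  !(s_step, t_step, u_step).
rewrite fa gb hc fb fc ga gc ha hb -fg -fh.
by congr (_ - _ *: _ - _ *: _ - _ *: _); ring.
Qed.

End Reflections.

Section Orders.
Variable W : groupType.

Lemma has_order_uniq (w : W) m n : has_order w m -> has_order w n -> m = n.
Proof.
move=> [m0 m1 mm] [n0 n1 nn]; case: (ltngtP m n) => // l.
- by case: (nn m); rewrite ?m0.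
- by case: (mm n); rewrite ?n0.
Qed.

Lemma braid_expg3 (G : groupType) (x y : G) : (x * x = 1)%g -> (y * y = 1)%g ->
  (x * y * x = y * x * y)%g -> ((x * y) ^+ 3 = 1)%g.
Proof.
move=> xx yy xyx.
have -> : ((x * y) ^+ 3 = (x * y * x) * (y * x * y))%g.
  by rewrite !expgS expg0 mulg1 !mulgA.
rewrite -xyx !mulgA -[(_ * x * x)%g]mulgA xx mulg1.
by rewrite -[(_ * y * y)%g]mulgA yy mulg1 xx.
Qed.

End Orders.

(** * Relations between edges, and homomorphisms out of W *)

Section Relations.
Variables (k : comNzRingType) (W : groupType) (S : set W).
Variables (V : realization k S) (X H : set V) (xi : V -> {scalar V}).
Hypothesis D : orthant_coords X H xi.
Hypothesis faithful : faithful_rep V.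

Lemma faithful_eq w w' : (forall v : V, ract w v = ract w' v) -> w = w'.
Proof.
move=> ww'; have /(congr1 (mulg w')) : (w'^-1 * w = 1)%g.
  apply: faithful => v; rewrite actM ww' -actM mulVg act1 //.
by rewrite mulVKg mulg1.
Qed.

(** The coroot once the root is rescaled to x - y - h; it does not depend on h. *)
Definition edge_form (x y : V) : {scalar V} := xi x \- xi y.

Lemma edge_formE x y v : edge_form x y v = xi x v - xi y v.
Proof. by []. Qed.

Lemma edge_act s x y h : edge_at X H xi s x y h ->
  forall v, ract (val s) v = v - edge_form x y v *: (x - y - h).
Proof. by case. Qed.

Lemma edge_pairing s t x y h x' y' h' :
    edge_at X H xi s x y h -> edge_at X H xi t x' y' h' ->
  edge_form x y (x' - y' - h') =
    (x == x')%:R - (x == y')%:R - ((y == x')%:R - (y == y')%:R).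
Proof.
move=> [Xx Xy _ _ _] [Xx' Xy' _ hH' _]; rewrite edge_formE !(raddfB (xi _)) /=.
by rewrite !(xi_spanH D _ hH') // !(xi_X D) // !subr0.
Qed.

Lemma edge_form2 s x y h : edge_at X H xi s x y h ->
  edge_form x y (x - y - h) = 2.
Proof.
move=> e; rewrite (edge_pairing e e) !eqxx; have [_ _ /eqP xy _ _] := e.
by rewrite (negPf xy) eq_sym (negPf xy) subr0 sub0r opprK.
Qed.

Lemma edge_sq (s : S) : (val s * val s = 1)%g.
Proof.
have [x [y [h e]]] := edge_exists D s; apply: faithful => v.
by rewrite actM; apply: (refl_sq (edge_act e) v (edge_form2 e)).
Qed.

Lemma share_edges s t z : moved X s `&` moved X t = [set z] ->
  exists x y h h', [/\ edge_at X H xi s z x h, edge_at X H xi t z y h' & x <> y].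
Proof.
move=> st; have [x [x' [h es]]] := edge_exists D s.
have [y [y' [h' et]]] := edge_exists D t.
have [zs zt] : (moved X s `&` moved X t) z by rewrite st.
wlog zx : x x' h es / z = x.
  move=> W0; have : moved X s z by []; rewrite (edge_moved D es) => -[/= zx|/= zx].
    exact: W0 es zx.
  exact: W0 (edge_sym es) zx.
wlog zy : y y' h' et / z = y.
  move=> W0; have : moved X t z by []; rewrite (edge_moved D et) => -[/= zy|/= zy].
    exact: W0 et zy.
  exact: W0 (edge_sym et) zy.
subst x y; exists x', y', h, h'; split=> // xy.
have : (moved X s `&` moved X t) x'.
  by rewrite (edge_moved D es) (edge_moved D et) xy; split; right.
by rewrite st => /= x'z; have [_ _ []] := es.
Qed.

Lemma share_pairing s t z x y h h' :
    edge_at X H xi s z x h -> edge_at X H xi t z y h' -> x <> y ->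
  edge_form z x (z - y - h') = 1.
Proof.
move=> es et /eqP xy; rewrite (edge_pairing es et) eqxx (negPf xy) subr0.
have [_ _ /eqP zx _ _] := es; have [_ _ /eqP zy _ _] := et.
by rewrite (negPf zy) eq_sym (negPf zx) !subr0.
Qed.

Lemma disjoint_pairing s t x y h x' y' h' :
    edge_at X H xi s x y h -> edge_at X H xi t x' y' h' ->
  moved X s `&` moved X t = set0 -> edge_form x y (x' - y' - h') = 0.
Proof.
move=> es et; rewrite (edge_moved D es) (edge_moved D et) => st0.
have N u v : [set x; y] u -> [set x'; y'] v -> (u == v) = false.
  by move=> hu hv; apply/eqP => uv; have : set0 u by rewrite -st0; split; rewrite // uv.
by rewrite (edge_pairing es et) !N ?subrr //; (by left) || (by right).
Qed.

Lemma coroot_pairing s t x y h x' y' h' :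
    edge_at X H xi s x y h -> edge_at X H xi t x' y' h' ->
  simple_coroot V s (simple_root V t) = edge_form x y (x' - y' - h') *
    (simple_coroot V s x * xi x' (simple_root V t)).
Proof.
move=> es et; rewrite (edge_coroot D _ es) -edge_formE.
have [_ {1}->] := edge_root D et; rewrite scalarZ; ring.
Qed.

Lemma share_braid (s t : S) z : moved X s `&` moved X t = [set z] ->
  (val s * val t * val s = val t * val s * val t)%g.
Proof.
move=> /share_edges[x [y [h [h' [es et xy]]]]]; apply: faithful_eq => v.
rewrite !actM.
have st := share_pairing es et xy; have ts := share_pairing et es (nesym xy).
apply: (refl_braid (edge_act es) (edge_act et)).
- exact: edge_form2 es.
- exact: edge_form2 et.
- by rewrite st ts.
- by rewrite st mulr1.
Qed.

(** The braid relation bounds the order by 3. Order 1 would give s = t, and order 2 would, by the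
    axiom on coroots, make zero a pairing that is a product of units. *)
Lemma share_order (s t : S) z m : moved X s `&` moved X t = [set z] ->
  has_order (val s * val t)%g m -> m = 3%N.
Proof.
move=> stz ord; have [m0 mm mj] := ord.
have e3 := braid_expg3 (edge_sq s) (edge_sq t) (share_braid stz).
have [x [y [h [h' [es et xy]]]]] := share_edges stz.
have st_ne : s <> t.
  move=> st; move: stz; rewrite -st setIid (edge_moved D es) => zx.
  have : [set z] x by rewrite -zx; right.
  by move=> /= xz; have [_ _ []] := es.
have [m3|m3] := leqP m 3; last by case: (mj 3).
case: m m0 mm mj ord m3 => [|[|[|[|m]]]] // _ mm mj ord _.
- case: st_ne; apply: val_inj; rewrite expg1 in mm.
  by rewrite -[LHS]mulg1 -(edge_sq t) mulgA mm mul1g.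
- have := (coroot_eq0 V st_ne).2 ord; rewrite (coroot_pairing es et).
  have [u _] := edge_root D es; have [u' _] := edge_root D et.
  rewrite (share_pairing es et xy) mul1r => c0.
  move: u u' c0; set a := simple_coroot V s z; set b := xi z _.
  set c := simple_coroot V t z; set d := xi z _ => u u' c0.
  have : (a * b) * (c * d) = (a * d) * (b * c) by ring.
  by rewrite u u' c0 mul1r mul0r => /eqP; rewrite oner_eq0.
Qed.

Lemma disjoint_order (s t : S) m : moved X s `&` moved X t = set0 ->
  has_order (val s * val t)%g m -> m = 2%N.
Proof.
move=> st0 ord; have [x [y [h es]]] := edge_exists D s.
have [x' [y' [h' et]]] := edge_exists D t.
have st_ne : s <> t.
  move=> st; move: st0; rewrite -st setIid (edge_moved D es) => x0.
  have : set0 x by rewrite -x0; left.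
  by [].
apply: (has_order_uniq ord); apply: (coroot_eq0 V st_ne).1.
by rewrite (coroot_pairing es et) (disjoint_pairing es et st0) mul0r.
Qed.

Lemma zspanH_int b v : H b -> zspan H v -> exists n : int, xi b v = n%:~R.
Proof.
move=> Hb; pose P (v : zmodule V) := exists n : int, xi b (v : V) = n%:~R.
apply: (lspan_ind (P := P)) => [c Hc|a u w [m um] [n wn]|].
- by exists (b == c)%:R; rewrite (xiE D) ?rmorph_nat //; right.
- exists (a * m + n); rewrite scalezrE.
  change (xi b ((u : V) *~ a + w) = (a * m + n)%:~R).
  by rewrite raddfD raddfMz /= um wn rmorphD rmorphM mulrzl.
- by exists 0; apply: (raddf0 (xi b)).
Qed.

Lemma zspanH_torsion_free v n : zspan H v -> n.+1%:R *: v = 0 -> v = 0.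
Proof.
move=> vH nv; apply: (coord_eq D) => b [Xb|Hb].
  by rewrite (xi_spanH D Xb vH) raddf0.
have [m mE] := zspanH_int Hb vH; rewrite raddf0 mE.
move/(congr1 (xi b)): nv; rewrite scalarZ raddf0 mE => nm.
suff -> : m = 0 by [].
have : (n.+1%:Z * m)%:~R = 0%:~R :> k by rewrite rmorphM.
by move/(int_inj D)/eqP; rewrite mulf_eq0 /= => /eqP.
Qed.

Lemma same_moved_edge s t x y h : edge_at X H xi s x y h ->
  moved X s = moved X t -> exists h', edge_at X H xi t x y h'.
Proof.
move=> es; rewrite (edge_moved D es) => /esym st; apply: (joins_edge D).
have [_ _ xy _ _] := es; split=> //; exists x.
by have [] : moved X t x by rewrite st; left.
Qed.

Lemma edge_inj s t x y h : edge_at X H xi s x y h -> edge_at X H xi t x y h ->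
  s = t.
Proof.
move=> es et; apply/val_inj/faithful_eq => v.
by rewrite (edge_act es) (edge_act et).
Qed.

(** (st)^n sends x to x + n (h' - h), and Span_Z H has no torsion. A finite order therefore forces h
    = h', and then s and t act alike. *)
Lemma same_order (s t : S) m : moved X s = moved X t -> s <> t ->
  has_order (val s * val t)%g m -> False.
Proof.
move=> st st_ne [m0 mm _]; have [x [y [h es]]] := edge_exists D s.
have [h' et] := same_moved_edge es st.
have [Xx Xy /eqP xy hH _] := es; have [_ _ _ hH' _] := et.
have stH v : zspan H v -> ract (val s * val t)%g v = v by apply: (act_spanH D).
have E n : ract ((val s * val t) ^+ n)%g x = x + n%:R *: (h' - h).
  elim: n => [|n IH]; first by rewrite expg0 act1 scale0r addr0.
  have -> : n.+1%:R *: (h' - h) = (h' - h) + n%:R *: (h' - h).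
    by rewrite -add1n natrD scalerDl scale1r.
  rewrite expgSr actM [ract (_ * _)%g x]actM (edge_l D et).
  have actD w u v : ract w (u + v) = ract w u + ract w v :> V.
    by have := act_linear w 1 u v; rewrite !scale1r.
  rewrite actD (edge_r D es) (act_spanH D _ hH').
  have -> : x - h + h' = x + (h' - h) by rewrite -addrA [- h + _]addrC.
  rewrite actD IH (act_spanH D _ (spanD hH' (lspanN (hH : zspan H h)))).
  by rewrite -addrA [(h' - h) + _]addrC addrA addrA.
case: m m0 mm => // m _ mm; move: (E m.+1); rewrite mm act1.
move=> /(congr1 (fun u => u - x)); rewrite subrr addrAC subrr add0r => /esym.
move/(zspanH_torsion_free (spanD hH' (lspanN (hH : zspan H h)))) => /eqP.
rewrite subr_eq0 => /eqP hh'; apply: st_ne; apply: edge_inj es _.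
by rewrite -hh'.
Qed.

Lemma moved_cases (s t : S) : [\/ moved X s `&` moved X t = set0,
  exists z, moved X s `&` moved X t = [set z] | moved X s = moved X t].
Proof.
have [x [y [h es]]] := edge_exists D s.
have [x' [y' [h' et]]] := edge_exists D t.
have [_ _ /eqP xy _ _] := es; have [_ _ /eqP xy' _ _] := et.
rewrite (edge_moved D es) (edge_moved D et).
have I u v u' v' : u != v -> u' != v' -> u = u' -> v != v' ->
    exists z, [set u; v] `&` [set u'; v'] = [set z].
  move=> uv uv' -> vv'; exists u'; apply/seteqP; split=> z /=; last first.
    by move=> ->; split; left.
  by move=> [[//|->] [//|/eqP]]; rewrite (negPf vv').
have setC2 (u v : V) : [set u; v] = [set v; u] by rewrite setUC.
have [xx|xx] := eqVneq x x'.
  have [yy|yy] := eqVneq y y'; first by apply: Or33; rewrite xx yy.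
  by apply: Or32; apply: I.
have [yy|yy] := eqVneq y y'.
  apply: Or32; rewrite setC2 [[set x'; _]]setC2.
  by apply: I => //; rewrite eq_sym.
have [xy1|xy1] := eqVneq x y'.
  have [yx1|yx1] := eqVneq y x'.
    by apply: Or33; rewrite xy1 yx1 setC2.
  by apply: Or32; rewrite [[set x'; _]]setC2; apply: I => //; rewrite eq_sym.
have [yx1|yx1] := eqVneq y x'.
  by apply: Or32; rewrite setC2; apply: I => //; rewrite eq_sym.
apply: Or31; rewrite -subset0 => z /= [[->|->] [] /eqP].
- by rewrite (negPf xx).
- by rewrite (negPf xy1).
- by rewrite (negPf yx1).
- by rewrite (negPf yy).
Qed.

Hypothesis cox : coxeter_system S.

(** Nothing is asked of two edges with the same endpoints, since their product has infinite order.
    Both the Tits representation and the projections onto the factors of W are built with this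
    lemma. *)
Lemma coxeter_lift (G : groupType) (f : S -> G) :
    (forall s, (f s * f s = 1)%g) ->
    (forall s t, moved X s `&` moved X t = set0 -> (f s * f t = f t * f s)%g) ->
    (forall s t z, moved X s `&` moved X t = [set z] ->
       (f s * f t * f s = f t * f s * f t)%g) ->
  exists2 F : W -> G, {morph F : x y / (x * y)%g} & forall s, F (val s) = f s.
Proof.
move=> fsq fcomm fbraid.
(* The universal property is stated for functions on all of W; the value 1 outside S is
   arbitrary. *)
pose f' (w : W) : G := if pselect (S w) is left Sw then f (SigSub (mem_set Sw)) else 1%g.
have f'E (s : S) : f' (val s) = f s.
  rewrite /f'; case: pselect => [Sw|[]]; last exact: set_valP.
  by congr f; apply: val_inj.
have [_ _ univ] := cox.
have [|F FM FS] := univ G f'.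
  move=> w w' m Sw Sw'.
  have [s <-] : exists s : S, val s = w by exists (SigSub (mem_set Sw)).
  have [t <-] : exists t : S, val t = w' by exists (SigSub (mem_set Sw')).
  move=> ord; rewrite !f'E.
  have [-> |st] := eqVneq s t; first by rewrite fsq expg1n.
  have [st0|[z stz]|ss] := moved_cases s t.
  - rewrite (disjoint_order st0 ord) expgS expg1 {2}(fcomm _ _ st0).
    by rewrite mulgA -[(_ * _ * f t)%g]mulgA fsq mulg1 fsq.
  - by rewrite (share_order stz ord); apply: braid_expg3 => //; apply: fbraid stz.
  - by case: (same_order ss _ ord); apply/eqP.
by exists F => // s; rewrite FS ?f'E //; apply: set_valP.
Qed.

End Relations.

(** * Vertices have degree at most 2 *)

(** The group of bijections of T, with inverses kept as data. For T = S -> int it is the target of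
    the Tits representation. *)
Record autmap (T : Type) := AutMap {
  am_fun :> T -> T;
  am_inv : T -> T;
  am_funK : cancel am_fun am_inv;
  am_invK : cancel am_inv am_fun }.

Section AutMap.
Variable T : Type.
Implicit Types f g : autmap T.

Lemma autmapP f g : (forall x, f x = g x) -> f = g.
Proof.
case: f g => [f f' fK fVK] [g g' gK gVK] /= fg.
have E : f = g by apply: funext.
subst g; have E : f' = g' by apply: funext => x; rewrite -{1}[x]gVK fK.
by subst g'; congr AutMap; apply: Prop_irrelevance.
Qed.

HB.instance Definition _ := gen_eqMixin (autmap T).
HB.instance Definition _ := gen_choiceMixin (autmap T).

Definition am_one := @AutMap T id id (fun=> erefl) (fun=> erefl).
Definition am_mul f g :=
  AutMap (can_comp (am_funK f) (am_funK g)) (can_comp (am_invK g) (am_invK f)).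
Definition am_opp f := AutMap (am_invK f) (am_funK f).

Fact am_mulA : associative am_mul. Proof. by move=> f g h; apply: autmapP. Qed.
Fact am_mul1 : left_id am_one am_mul. Proof. by move=> f; apply: autmapP. Qed.
Fact am_mulr1 : right_id am_one am_mul. Proof. by move=> f; apply: autmapP. Qed.
Fact am_mulV : left_inverse am_one am_opp am_mul.
Proof. by move=> f; apply: autmapP => x /=; rewrite am_funK. Qed.
Fact am_mulrV : right_inverse am_one am_opp am_mul.
Proof. by move=> f; apply: autmapP => x /=; rewrite am_invK. Qed.

HB.instance Definition _ := isGroup.Build (autmap T)
  am_mulA am_mul1 am_mulr1 am_mulV am_mulrV.

Lemma am_mulE f g x : (f * g)%g x = f (g x).
Proof. by []. Qed.

End AutMap.

Section Degree.
Variables (k : comNzRingType) (W : groupType) (S : set W).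
Variables (V : realization k S) (X H : set V) (xi : V -> {scalar V}).
Hypothesis D : orthant_coords X H xi.
Hypothesis faithful : faithful_rep V.
Hypothesis cox : coxeter_system S.

(** Twice the Tits form, with entries -2cos(π/m): 2 on the diagonal, and 0, -1, -2 for m = 2, 3,
    ∞. *)
Definition geom_form (s t : S) : int :=
  if s == t then 2 else if `[< moved X s = moved X t >] then -2
  else if `[< moved X s `&` moved X t = set0 >] then 0 else -1.

Lemma geom_formC s t : geom_form s t = geom_form t s.
Proof.
rewrite /geom_form eq_sym setIC; case: (_ == _) => //.
by rewrite (_ : (moved X t = moved X s) = (moved X s = moved X t)) //; apply/propext; split.
Qed.

Lemma geom_formxx s : geom_form s s = 2.
Proof. by rewrite /geom_form eqxx. Qed.

Lemma geom_form_disjoint s t :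
  moved X s `&` moved X t = set0 -> geom_form s t = 0.
Proof.
have [x [y [h e]]] := edge_exists D s.
have sx : moved X s x by rewrite (edge_moved D e); left.
rewrite /geom_form; case: eqP => [<-|_].
  by rewrite setIid => s0; rewrite s0 in sx.
case: asboolP => [<-|_]; first by rewrite setIid => s0; rewrite s0 in sx.
by move=> st0; case: asboolP.
Qed.

Lemma geom_form_share s t z :
  moved X s `&` moved X t = [set z] -> geom_form s t = -1.
Proof.
move=> st; have [x [y [h [h' [es et xy]]]]] := share_edges D st.
have ne : moved X s <> moved X t.
  move=> E; move: st; rewrite -E setIid (edge_moved D es) => zx.
  have : [set z] x by rewrite -zx; right.
  by move=> /= xz; have [_ _ []] := es.
rewrite /geom_form; case: eqP => [E|_]; first by case: ne; rewrite E.
case: asboolP => // _; case: asboolP => // E; rewrite E in st.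
by have : set0 z by rewrite st.
Qed.

Lemma geom_form_same s t : moved X s = moved X t -> s <> t -> geom_form s t = -2.
Proof. by rewrite /geom_form => E /eqP/negPf ->; case: asboolP. Qed.

Definition geom_refl (s : S) (g : S -> int) : S -> int :=
  fun u => g u - geom_form s u * g s.

Lemma geom_reflK s : cancel (geom_refl s) (geom_refl s).
Proof.
by move=> g; apply: funext => u; rewrite /geom_refl geom_formxx; ring.
Qed.

(* The Tits representation: the Coxeter group acts on the dual of the free
   module on S, although the reflections of V only realise a quotient of it
   when some vertex of the transposition graph has degree 3. *)
Lemma geom_rep : exists2 F : W -> autmap (S -> int),
  {morph F : x y / (x * y)%g} & forall (s : S) g, F (val s) g = geom_refl s g.
Proof.
pose f s := AutMap (geom_reflK s) (geom_reflK s).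
have [|s t st0|s t z st|F FM FE] := @coxeter_lift _ _ _ _ _ _ _ D faithful cox _ f.
- by move=> s; apply: autmapP => g; apply: geom_reflK.
- apply: autmapP => g; apply: funext => u; rewrite !am_mulE /= /geom_refl.
  by rewrite [geom_form t s]geom_formC (geom_form_disjoint st0); ring.
- apply: autmapP => g; apply: funext => u; rewrite !am_mulE /= /geom_refl.
  rewrite !geom_formxx [geom_form t s]geom_formC (geom_form_share st).
  by ring.
- by exists F => // s g; rewrite FE.
Qed.

(** A functional equal to 1 on every simple root is interior to the fundamental chamber, where
    stabilizers are trivial. Any false relation is therefore visible on it. *)
Let one : S -> int := fun=> 1.

(** The relation says that s commutes with t u t. In the Tits representation the root of t u t is
    the sum of those of t and u, and its pairing with the root of s is -1 - 1 = -2 instead of 0. *)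
Lemma star_relation_false s t u :
    [/\ geom_form s t = -1, geom_form s u = -1 & geom_form t u = -1] ->
  (val s * val t * val u * val t = val t * val u * val t * val s)%g -> False.
Proof.
move=> [st su tu] E; have [F FM FE] := geom_rep.
have := congr1 (fun w => F w one s) E.
rewrite !FM !am_mulE !FE /geom_refl !geom_formxx.
by rewrite ![geom_form u _]geom_formC [geom_form t s]geom_formC st su tu.
Qed.

(** A braid relation between t and u s u would need the pairing ±1. Here the root of u s u is the
    sum of those of s and u, and its pairing with the root of t is -2 - 1 = -3. *)
Lemma lasso_relation_false s t u :
    [/\ geom_form s t = -2, geom_form s u = -1 & geom_form t u = -1] ->
  (val u * val s * val u * val t * val u * val s * val u =
     val t * val u * val s * val u * val t)%g -> False.
Proof.
move=> [st su tu] E; have [F FM FE] := geom_rep.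
have := congr1 (fun w => F w one s) E.
rewrite !FM !am_mulE !FE /geom_refl !geom_formxx.
by rewrite ![geom_form u _]geom_formC [geom_form t s]geom_formC st su tu.
Qed.

(** The two sides agree at s, by the symmetry between t and u; they are separated at t, where their
    values are -9 and 23. *)
Lemma parallel_relation_false s t u :
    [/\ geom_form s t = -2, geom_form s u = -2 & geom_form t u = -2] ->
  (val t * val s * val u = val u * val s * val t)%g -> False.
Proof.
move=> [st su tu] E; have [F FM FE] := geom_rep.
have := congr1 (fun w => F w one t) E.
rewrite !FM !am_mulE !FE /geom_refl !geom_formxx.
by rewrite ![geom_form u _]geom_formC [geom_form t s]geom_formC st su tu.
Qed.

Lemma moved_edge s y : moved X s y -> exists a h, edge_at X H xi s y a h.
Proof.
have [x [a [h e]]] := edge_exists D s; rewrite (edge_moved D e) => -[/= ->|/= ->].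
  by exists a, h.
by exists x, (- h); apply: edge_sym.
Qed.

Lemma share_moved s t y a b h h' :
    edge_at X H xi s y a h -> edge_at X H xi t y b h' -> a <> b ->
  moved X s `&` moved X t = [set y].
Proof.
move=> es et ab; rewrite (edge_moved D es) (edge_moved D et).
apply/seteqP; split=> z /=; last by move=> ->; split; left.
by move=> [[//|->] [//|]].
Qed.

Lemma same_moved s t y a h h' :
    edge_at X H xi s y a h -> edge_at X H xi t y a h' -> moved X s = moved X t.
Proof. by move=> es et; rewrite (edge_moved D es) (edge_moved D et). Qed.

Lemma same_pairing s t x y h h' :
    edge_at X H xi s x y h -> edge_at X H xi t x y h' ->
  edge_form xi x y (x - y - h') = 2.
Proof.
move=> es et; have [_ _ /eqP xy _ _] := es.
by rewrite (edge_pairing D es et) !eqxx [y == x]eq_sym (negPf xy) subr0 sub0r opprK.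
Qed.

Lemma no_star s t u y a b c h h' h'' :
    edge_at X H xi s y a h -> edge_at X H xi t y b h' ->
    edge_at X H xi u y c h'' ->
  a <> b -> a <> c -> b <> c -> False.
Proof.
move=> es et eu ab ac bc; apply: (@star_relation_false s t u).
  by split; apply: geom_form_share; apply: share_moved; eassumption.
apply: (faithful_eq faithful) => v; rewrite !actM.
apply: (refl_star (edge_act es) (edge_act et) (edge_act eu)); split.
- exact: (edge_form2 D es).
- exact: (edge_form2 D et).
- exact: (edge_form2 D eu).
- exact: (share_pairing D es et ab).
- exact: (share_pairing D es eu ac).
- exact: (share_pairing D et es (nesym ab)).
- exact: (share_pairing D et eu bc).
- exact: (share_pairing D eu es (nesym ac)).
- exact: (share_pairing D eu et (nesym bc)).
Qed.

Lemma no_lasso s t u y a c h h' h'' :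
    edge_at X H xi s y a h -> edge_at X H xi t y a h' ->
    edge_at X H xi u y c h'' -> s <> t -> a <> c -> False.
Proof.
move=> es et eu st ac; apply: (@lasso_relation_false s t u).
  split; first exact: (geom_form_same (same_moved es et) st).
    exact: (geom_form_share (share_moved es eu ac)).
  exact: (geom_form_share (share_moved et eu ac)).
apply: (faithful_eq faithful) => v; rewrite !actM.
have [_ _ /eqP ya _ _] := es; have [_ _ /eqP yc _ _] := eu.
move/eqP: (ac) => ac'.
(* Reversing both parallel edges makes their pairings with u equal to -1, as in [refl_lasso], and
   keeps their mutual pairing at 2. *)
have es' := edge_sym es; have et' := edge_sym et.
apply: (refl_lasso (edge_act es') (edge_act et') (edge_act eu)); split.
- exact: (edge_form2 D es').
- exact: (edge_form2 D et').
- exact: (edge_form2 D eu).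
- exact: (same_pairing es' et').
- by rewrite (edge_pairing D es' eu) eqxx (eq_sym a y) (negPf ya) (negPf ac') (negPf yc)
    !subr0 sub0r.
- exact: (same_pairing et' es').
- by rewrite (edge_pairing D et' eu) eqxx (eq_sym a y) (negPf ya) (negPf ac') (negPf yc)
    !subr0 sub0r.
- by rewrite (edge_pairing D eu es') eqxx (negPf ya) (eq_sym c a) (negPf ac') (eq_sym c y)
    (negPf yc) !subr0 sub0r.
- by rewrite (edge_pairing D eu et') eqxx (negPf ya) (eq_sym c a) (negPf ac') (eq_sym c y)
    (negPf yc) !subr0 sub0r.
Qed.

Lemma no_parallel s t u y a h h' h'' :
    edge_at X H xi s y a h -> edge_at X H xi t y a h' ->
    edge_at X H xi u y a h'' -> s <> t -> s <> u -> t <> u -> False.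
Proof.
move=> es et eu st su tu; apply: (@parallel_relation_false s t u).
  by split; apply: geom_form_same => //; apply: same_moved; eassumption.
apply: (faithful_eq faithful) => v; rewrite !actM.
apply: (refl_parallel (edge_act es) (edge_act et) (edge_act eu)) => //; split.
- exact: (same_pairing es es).
- exact: (same_pairing et et).
- exact: (same_pairing eu eu).
- exact: (same_pairing es et).
- exact: (same_pairing es eu).
- exact: (same_pairing et es).
- exact: (same_pairing et eu).
- exact: (same_pairing eu es).
- exact: (same_pairing eu et).
Qed.

(** The cases are the possible coincidences between the three far endpoints. *)
Lemma degree_le2 s t u y : moved X s y -> moved X t y -> moved X u y ->
  [\/ s = t, s = u | t = u].
Proof.
move=> /moved_edge[a [h es]] /moved_edge[b [h' et]] /moved_edge[c [h'' eu]].
have [->|/eqP st] := eqVneq s t; first exact: Or31.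
have [->|/eqP su] := eqVneq s u; first exact: Or32.
have [->|/eqP tu] := eqVneq t u; first exact: Or33.
exfalso; have [ab|/eqP ab] := eqVneq a b.
  rewrite -{}ab in et; have [ac|/eqP ac] := eqVneq a c.
    by rewrite -{}ac in eu; apply: (no_parallel es et eu).
  exact: (no_lasso es et eu st ac).
have [ac|/eqP ac] := eqVneq a c.
  by rewrite -{}ac in eu; apply: no_lasso es eu et su ab.
have [bc|/eqP bc] := eqVneq b c.
  by rewrite -{}bc in eu; apply: no_lasso et eu es tu (nesym ab).
exact: (no_star es et eu ab ac bc).
Qed.

End Degree.

(** * Components are paths or cycles *)

Section LabellingExists.
Variables (k : comNzRingType) (W : groupType) (S : set W).
Variables (V : realization k S) (X H : set V) (xi : V -> {scalar V}).
Hypothesis D : orthant_coords X H xi.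
Hypothesis faithful : faithful_rep V.
Hypothesis cox : coxeter_system S.
Hypothesis hfin : finite_set S \/ finite_set X.

Lemma joins_sym s (x y : V) : joins X s x y -> joins X s y x.
Proof. by move=> [? xy m]; split=> //; [exact: nesym | rewrite m setUC]. Qed.

Lemma joins_moved s (x y : V) : joins X s x y -> moved X s x.
Proof. by move=> [_ _ ->]; left. Qed.

Lemma joins_X s (x y : V) : joins X s x y -> X x.
Proof. by move/joins_moved => []. Qed.

Lemma connected_trans (x y z : V) :
  connected_to X x y -> connected_to X y z -> connected_to X x z.
Proof.
by move=> xy; elim=> // u v s _ xu uv; apply: connected_step xu uv.
Qed.

Lemma connected_sym (x y : V) : connected_to X x y -> connected_to X y x.
Proof.
elim=> [|u v s _ ux uv]; first exact: connected_refl.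
apply: connected_trans ux; apply: connected_step (joins_sym uv).
exact: connected_refl.
Qed.

Section Component.
Variable C : component X.

Lemma comp_connected (x y : V) :
  (sval C) x -> (sval C) y -> connected_to X x y.
Proof.
case: C => A /= [x0 _ ->] /= x0x x0y.
exact: connected_trans (connected_sym x0x) x0y.
Qed.

Lemma comp_sub (x : V) : (sval C) x -> X x.
Proof.
case: C => A /= [x0 Xx0 ->] /= x0x; case: _ / x0x => // y z s _.
by move/joins_sym/joins_X.
Qed.

Lemma comp_joins s (x y : V) : (sval C) x -> joins X s x y -> (sval C) y.
Proof. by case: C => A /= [x0 _ ->] /= x0x /(connected_step x0x). Qed.

Lemma comp_nonempty : exists x, (sval C) x.
Proof. by case: C => A /= [x0 _ ->]; exists x0; apply: connected_refl. Qed.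

Lemma comp_closed_full (Q : V -> Prop) x : (sval C) x -> Q x ->
    (forall s y z, (sval C) y -> Q y -> joins X s y z -> Q z) ->
  forall y, (sval C) y -> Q y.
Proof.
move=> Cx Qx QS y Cy.
suff [] : (sval C) y /\ Q y by [].
elim: (comp_connected Cx Cy) => // u v s _ [Cu Qu] uv.
by split; [apply: comp_joins Cu uv | apply: QS Cu Qu uv].
Qed.

(** m counts the edges. The functions are total to ease extension at both ends; [x] beyond m and [e]
    from m on are irrelevant. *)
Definition simple_path m (x : nat -> V) (e : nat -> S) :=
  [/\ forall i, (i <= m)%N -> (sval C) (x i),
      forall i j, (i <= m)%N -> (j <= m)%N -> x i = x j -> i = j &
      forall i, (i < m)%N -> joins X (e i) (x i) (x i.+1)].

Lemma path_edge_inj m x e : simple_path m x e ->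
  forall i j, (i < m)%N -> (j < m)%N -> e i = e j -> i = j.
Proof.
move=> [_ xinj xe] i j im jm eij.
have [_ ne E] := xe i im; have [_ _ E'] := xe j jm.
rewrite eij E' in E.
have [[xx _]|[x1 x2]] := set2_inj (esym E) ne.
  by apply: xinj xx; apply: ltnW.
have i1 : i = j.+1 by apply: xinj x1; [apply: ltnW | ].
have j1 : i.+1 = j by apply: xinj x2; [ | apply: ltnW].
by lia.
Qed.

(** Either finiteness assumption suffices: a simple path has distinct edges in S and distinct
    vertices in X. *)
Lemma path_bound : exists N, forall m x e, simple_path m x e -> (m <= N)%N.
Proof.
have [/finite_seqP[r rE]|/finite_seqP[r rE]] := hfin.
  exists (size r) => m x e p.
  rewrite -[X in (X <= _)%N](size_iota 0 m) -(size_map (fun i => val (e i))).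
  apply: uniq_leq_size.
    rewrite map_inj_in_uniq ?iota_uniq // => i j.
    rewrite !mem_iota !add0n /= => im jm /val_inj.
    exact: path_edge_inj p _ _ im jm.
  by move=> _ /mapP[i _ ->]; move: (val (e i)) (set_valP (e i)) => w; rewrite rE.
exists (size r) => m x e [xC xinj _].
apply: ltnW; rewrite -[X in (X <= _)%N](size_iota 0 m.+1) -(size_map x).
apply: uniq_leq_size.
  rewrite map_inj_in_uniq ?iota_uniq // => i j.
  by rewrite !mem_iota !add0n /= !ltnS; apply: xinj.
move=> y /mapP[i]; rewrite mem_iota add0n /= ltnS => im ->.
by have := comp_sub (xC i im); rewrite rE.
Qed.

Lemma max_path : inhabited S -> exists m x e, simple_path m x e /\
  forall x' e', ~ simple_path m.+1 x' e'.
Proof.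
move=> [s0]; have [N NP] := path_bound; apply: contrapT => nmax.
have all m : exists x e, simple_path m x e.
  elim: m => [|m [x [e p]]].
    have [x Cx] := comp_nonempty; exists (fun=> x), (fun=> s0); split=> // i j.
    by rewrite !leqn0 => /eqP -> /eqP ->.
  apply: contrapT => np; apply: nmax; exists m, x, e; split=> // x' e' p'.
  by apply: np; exists x', e'.
by have [x [e /NP]] := all N.+1; rewrite ltnn.
Qed.

Section MaximalPath.
Variables (m : nat) (x : nat -> V) (e : nat -> S).
Hypothesis xe : simple_path m x e.
Hypothesis mmax : forall x' e', ~ simple_path m.+1 x' e'.

Lemma path_interior i s : (0 < i < m)%N -> moved X s (x i) ->
  s = e i.-1 \/ s = e i.
Proof.
case: i => // i /= im si; have [_ _ ej] := xe.
have i1 : moved X (e i) (x i.+1).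
  by apply: joins_moved; apply: joins_sym; apply: ej; apply: ltnW.
have i2 : moved X (e i.+1) (x i.+1) by apply: joins_moved; apply: ej.
have [E|E|E] := degree_le2 D faithful cox i1 i2 si.
- by have := path_edge_inj xe (ltnW im) im E; lia.
- by left.
- by right.
Qed.

(** An edge leaving the path at one of its ends would prolong it, against maximality. At an inner
    vertex the two path edges already exhaust the degree. *)
Lemma path_closed i s z : (i <= m)%N -> joins X s (x i) z ->
  exists2 j, (j <= m)%N & z = x j.
Proof.
move=> im sxz; apply: contrapT => nz.
have {}nz j : (j <= m)%N -> x j <> z by move=> jm E; apply: nz; exists j.
have [xC xinj ej] := xe.
have zC : (sval C) z by apply: comp_joins sxz; apply: xC.
have [i0|i0] := posnP i.
  apply: (mmax (x' := fun n => if n is n'.+1 then x n' else z)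
               (e' := fun n => if n is n'.+1 then e n' else s)).
  split=> [[|j] //|[|j] [|l] // jm lm /=|[|j] jm] /=.
  - exact: xC.
  - by move/esym/nz; case.
  - by move/nz; case.
  - by move/xinj => ->.
  - by rewrite -i0; apply: joins_sym.
  - exact: ej.
have [E|i_m] := eqVneq i m.
  apply: (mmax (x' := fun n => if (n <= m)%N then x n else z)
               (e' := fun n => if (n < m)%N then e n else s)).
  split=> [j|j l|j]; rewrite ?ltnS.
  - by case: (leqP j m) => // jm _; apply: xC.
  - case: (leqP j m) => jm; case: (leqP l m) => lm // j1 l1.
    + exact: xinj.
    + by move/nz; case.
    + by move/esym/nz; case.
    + by move=> _; lia.
  - case: (ltngtP j m) => // [jm _|-> _]; last by rewrite -E.
    exact: ej.
have im' : (0 < i < m)%N by rewrite i0 ltn_neqAle i_m.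
have [E|E] := path_interior im' (joins_moved sxz).
  have [_ _ mv] := ej i.-1 (ltac:(lia)).
  have : moved X s z by apply: joins_moved (joins_sym sxz).
  by rewrite E mv => -[/= /esym/nz|/= /esym/nz]; apply; lia.
have [_ _ mv] := ej i (ltac:(lia)).
have : moved X s z by apply: joins_moved (joins_sym sxz).
by rewrite E mv => -[/= /esym/nz|/= /esym/nz]; apply; lia.
Qed.

Lemma path_full y : (sval C) y -> exists2 j, (j <= m)%N & y = x j.
Proof.
have [xC xinj ej] := xe.
apply: (comp_closed_full (Q := fun y => exists2 j, (j <= m)%N & y = x j)
  (xC 0%N isT)); first by exists 0%N.
by move=> s u z Cu [j jm ->] /(path_closed jm).
Qed.

(** Inner vertices are saturated by the path, so an edge off the path can only join its two ends. *)
Lemma path_chord s i j : (i < j <= m)%N -> joins X s (x i) (x j) ->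
  (exists2 l, (l < m)%N & s = e l) \/ [/\ i = 0%N, j = m & (0 < m)%N].
Proof.
move=> ijm sij; have [i0|i0] := posnP i.
  have [->|jm] := eqVneq j m; first by right; split=> //; lia.
  have j1 : (0 < j < m)%N by lia.
  have [->|->] := path_interior j1 (joins_moved (joins_sym sij)); left.
    by exists j.-1 => //; lia.
  by exists j => //; lia.
have i1 : (0 < i < m)%N by lia.
have [->|->] := path_interior i1 (joins_moved sij); left.
  by exists i.-1 => //; lia.
by exists i => //; lia.
Qed.

Lemma edges_in_joins s : edges_in C s -> exists i j,
  (i < j <= m)%N /\ joins X s (x i) (x j).
Proof.
move=> [_ mC]; have [y [z [h es]]] := edge_exists D s.
have syz := edge_joins_xy D es; have szy := joins_sym syz.
have [i im yE] := path_full (mC _ (joins_moved syz)).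
have [j jm zE] := path_full (mC _ (joins_moved szy)).
subst y z; have [_ ne _] := syz.
case: (ltngtP i j) => ij.
- by exists i, j; rewrite ij.
- by exists j, i; rewrite ij.
- by case: ne; rewrite ij.
Qed.

End MaximalPath.

Lemma joins_edges_in s y z : joins X s y z -> (sval C) y -> edges_in C s.
Proof.
move=> sxz Cy; have [nt _ mv] := sxz; split=> //; rewrite mv => u /= [->//|->].
exact: comp_joins sxz.
Qed.

Lemma path_vert_bij m x e : simple_path m x e ->
    (forall y, (sval C) y -> exists2 j, (j <= m)%N & y = x j) ->
  set_bij setT (sval C) (fun i : 'I_m.+1 => x i).
Proof.
move=> [xC xinj _] full; split=> [i _|i j _ _ xij|y /full[j jm ->]] /=.
- by apply: xC; rewrite -ltnS.
- by apply: val_inj; apply: xinj xij; rewrite -ltnS.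
- by exists (Ordinal (jm : (j < m.+1)%N)).
Qed.

Lemma finite_labelling m x e : simple_path m x e ->
    (forall y, (sval C) y -> exists2 j, (j <= m)%N & y = x j) ->
    (forall t, edges_in C t -> exists2 l, (l < m)%N & t = e l) ->
  inhabited (labelling C).
Proof.
move=> p full fulle; have [xC xinj ej] := p.
pose vt : 'I_(nverts (FiniteType m)) -> V := fun i => x i.
pose ed : 'I_(nedges (FiniteType m)) -> S := fun i => e i.
have vbij : set_bij setT (sval C) vt := path_vert_bij p full.
have ebij : set_bij setT (edges_in C) ed.
  split=> [i _|i j _ _ eij|t /fulle[l lm ->]] /=.
  - by apply: joins_edges_in (ej i (ltn_ord i)) _; apply: xC; apply: ltnW.
  - by apply: val_inj; apply: (path_edge_inj p) eij; apply: ltn_ord.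
  - by exists (Ordinal lm).
constructor; apply: (@Labelling _ _ _ _ _ _ (FiniteType m) vt ed) => // i.
exact: (ej i (ltn_ord i)).
Qed.

Lemma affine_labelling m x e s : simple_path m.+1 x e ->
    (forall y, (sval C) y -> exists2 j, (j <= m.+1)%N & y = x j) ->
    (forall t, edges_in C t -> t = s \/ exists2 l, (l < m.+1)%N & t = e l) ->
    (forall l, (l < m.+1)%N -> s <> e l) -> joins X s (x m.+1) (x 0%N) ->
  inhabited (labelling C).
Proof.
move=> p full fulle sn sj; have [xC xinj ej] := p.
pose vt : 'I_(nverts (AffineType m)) -> V := fun i => x i.
(* In affine type the edge i ends at the vertex i and starts at its cyclic predecessor; so the
   closing edge takes index 0 and the path edges move up by one. *)
pose ed : 'I_(nedges (AffineType m)) -> S := fun i => if (i : nat) is 0 then s else e i.-1.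
have vbij : set_bij setT (sval C) vt := path_vert_bij p full.
have edS (i : 'I_m.+2) l : i = l.+1 :> nat -> ed i = e l.
  by move=> il; rewrite /ed /= il.
have ed0 (i : 'I_m.+2) : i = 0%N :> nat -> ed i = s.
  by move=> il; rewrite /ed /= il.
have cs (i : 'I_m.+2) : i = 0%N :> nat \/ exists2 l, (l < m.+1)%N & i = l.+1 :> nat.
  by case: i => [[|i] lt]; [left | right; exists i].
have ebij : set_bij setT (edges_in C) ed.
  split=> [i _|i j _ _|t /fulle[->|[l lm ->]]] /=.
  - have [/ed0 ->|[l lm /edS ->]] := cs i.
      by apply: joins_edges_in sj _; apply: xC.
    by apply: joins_edges_in (ej _ lm) _; apply/xC/ltnW.
  - have [i0|[l lm il]] := cs i; have [j0|[l' lm' jl]] := cs j.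
    + by move=> _; apply: val_inj; rewrite /= i0 j0.
    + by rewrite ed0 // (edS _ _ jl) => /(sn _ lm').
    + by rewrite (edS _ _ il) ed0 // => /esym/(sn _ lm).
    + rewrite (edS _ _ il) (edS _ _ jl) => /(path_edge_inj p lm lm') ij.
      by apply: val_inj; rewrite /= il jl ij.
  - by exists ord0 => //; rewrite ed0.
  - by exists (Ordinal (lm : (l.+1 < m.+2)%N)) => //; apply: edS.
constructor; apply: (@Labelling _ _ _ _ _ _ (AffineType m) vt ed) => // i.
rewrite /vt /=; have [i0|[l lm il]] := cs i.
  by rewrite i0 (ed0 _ i0) /= modn_small.
rewrite (edS _ _ il) il addSn /= modnDr modn_small; last exact: ltnW.
exact: ej.
Qed.

(** Treated apart because a [simple_path], even of length 0, carries a function with values in S. *)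
Lemma edgeless_labelling : (S -> False) -> inhabited (labelling C).
Proof.
move=> nS; have [x Cx] := comp_nonempty.
have one (y : V) : (sval C) y -> y = x.
  by move=> Cy; case: _ / (comp_connected Cx Cy) => // u v /nS.
pose vt : 'I_(nverts (FiniteType 0)) -> V := fun=> x.
have ed : 'I_(nedges (FiniteType 0)) -> S by case.
constructor; apply: (@Labelling _ _ _ _ _ _ (FiniteType 0) vt ed).
- by split=> [i _ //|i j _ _ _|y /one ->]; [rewrite (ord1 i) (ord1 j) | exists ord0].
- by split=> [[]//|[]//|t]; case: (nS t).
- by case.
Qed.

(** A maximal path meets every vertex of C. Either its edges are all the edges of C, or an edge
    joining its ends closes it into a cycle, a double edge when m = 1. *)
Lemma labelling_exists : inhabited (labelling C).
Proof.
have [[s0]|nS] := pselect (inhabited S); last first.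
  by apply: edgeless_labelling => s; apply: nS.
have [m [x [e [p pmax]]]] := max_path (inhabits s0).
have full := path_full p pmax; have ej := edges_in_joins p pmax.
have [[s [sC sn]]|nex] :=
    pselect (exists s, edges_in C s /\ forall l, (l < m)%N -> s <> e l); last first.
  apply: (finite_labelling p full) => t tC; apply: contrapT => nt.
  by apply: nex; exists t; split=> // l lm tl; apply: nt; exists l.
have chord t : edges_in C t -> (exists2 l, (l < m)%N & t = e l) \/
    (0 < m)%N /\ joins X t (x 0%N) (x m).
  move=> /ej[i [j [ijm tij]]].
  have [?|[i0 jm m0]] := path_chord p ijm tij; first by left.
  by right; split=> //; rewrite -i0 -jm.
have [[l lm sl]|[m0 sj]] := chord s sC; first by case: (sn l lm).
case: m p full ej sn chord m0 sj {pmax} => // m p full ej sn chord _ sj.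
apply: (affine_labelling p full) (joins_sym sj) => // t /chord[|[_ tj]].
  by right.
(* A second closing edge would be a third edge at [x 0]. *)
have [_ _ /(_ 0%N isT) e0] := p.
have [E|E|E] := degree_le2 D faithful cox (joins_moved e0) (joins_moved sj) (joins_moved tj).
- by case: (sn 0%N) => //; rewrite E.
- by right; exists 0%N.
- by left.
Qed.

End Component.
End LabellingExists.

(** * Symmetric groups, affine Weyl groups and their permutation representations *)

Section WeylGeneration.

Lemma is_subgroup_prod (G : groupType) (A : set G) (I : Type) (r : seq I) (F : I -> G) :
  is_subgroup A -> (forall i, A (F i)) -> A (\prod_(i <- r) F i)%g.
Proof. by move=> [A1 AM _] AF; elim/big_ind: _. Qed.

Lemma sym_generated n (G : set 'S_n) : is_subgroup G ->
  (forall i j : 'I_n, j = i.+1 :> nat -> G (tperm i j)) -> forall s, G s.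
Proof.
move=> Gg Gadj s; have [ts -> _] := prod_tpermP s.
apply: is_subgroup_prod => // -[i j] /=.
have H d : forall i j : 'I_n, j = (i + d)%N :> nat -> G (tperm i j).
  elim: d => [|d IH] {}i {}j ij.
    have -> : j = i by apply: val_inj; rewrite /= ij addn0.
    by rewrite tperm1; case: Gg.
  have [d0|d0] := posnP d; first by apply: Gadj; rewrite ij d0 addn1.
  have lj : (i + d < n)%N by have := ltn_ord j; rewrite ij addnS; apply: ltnW.
  pose l := Ordinal lj.
  (* l = j - 1, so (l j) is an adjacent transposition and (i l) has a smaller gap. *)
  have -> : tperm i j = (tperm i l ^ tperm l j)%g.
    rewrite tpermJ tpermL tpermD //.
      by apply/eqP => /(congr1 val) /=; lia.
    by apply/eqP => /(congr1 val) /=; lia.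
  rewrite /conjg; have [_ GM GV] := Gg.
  have Glj : G (tperm l j) by apply: Gadj; rewrite ij addnS.
  by apply: (GM _ _ (GV _ Glj)); apply: GM => //; apply: IH.
have [ij|ji] := leqP i j; first by apply: (H (j - i)%N); rewrite subnKC.
by rewrite tpermC; apply: (H (i - j)%N); rewrite subnKC // ltnW.
Qed.

(** The reflections of index i > 0 generate the finite part. Multiplying the 0-th one by its
    permutation leaves the translation by e_0 - e_max; the conjugates of that and their inverses
    include all translations by e_j - e_0, which span the lattice of sum 0. *)
Lemma affWeyl_generated m (G : set (affWeyl m.+2)) : is_subgroup G ->
  (forall i, G (aff_refl i)) -> forall g, G g.
Proof.
move=> Gg Grefl; have [G1 GM GV] := Gg.
pose Gval s (q : 'rV[int]_m.+2) := exists2 g, G g & aw_val g = (s, q).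
have GvalM s q t r : Gval s q -> Gval t r -> Gval (s * t)%g (q + col_perm s r).
  by move=> [g Gg' gE] [h Gh hE]; exists (g * h)%g; [exact: GM | rewrite /= gE hE].
have GvalV s q : Gval s q -> Gval (s^-1)%g (- col_perm (s^-1)%g q).
  by move=> [g Gg' gE]; exists (g^-1)%g; [exact: GV | rewrite /= gE].
have lin s : Gval s 0.
  apply: (@sym_generated _ [set s | Gval s 0]) => [|i j ij].
    split=> [|x y|x] /=; first by exists 1%g.
      by move=> Gx Gy; have := GvalM _ _ _ _ Gx Gy; rewrite raddf0 addr0.
    by move=> Gx; have := GvalV _ _ Gx; rewrite raddf0 oppr0.
  exists (aff_refl j) => //=; rewrite /aff_refl_val.
  have -> : ord_pred j = i.
    by apply: val_inj; rewrite /= ij addSn /= modnDr modn_small.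
  by case: eqP => // j0; rewrite j0 in ij.
have pred0 : ord_pred ord0 = ord_max :> 'I_m.+2.
  by apply: val_inj; rewrite /= modn_small.
have theta : Gval 1%g (delta_mx 0 ord0 - delta_mx 0 ord_max).
  have := GvalM _ _ _ _ (ex_intro2 _ _ _ (Grefl ord0) erefl)
    (lin (tperm ord_max ord0)).
  by rewrite raddf0 addr0 pred0 tperm2.
have root j : Gval 1%g (delta_mx 0 j - delta_mx 0 ord0).
  have [->|j0] := eqVneq j ord0; first by rewrite subrr; apply: lin.
  have H s : Gval 1%g (col_perm s (delta_mx 0 ord0 - delta_mx 0 ord_max)).
    have := GvalM _ _ _ _ (GvalM _ _ _ _ (lin s) theta) (lin (s^-1)%g).
    by rewrite mulg1 mulgV raddf0 addr0 add0r.
  have := GvalV _ _ (H (tperm ord_max j)); rewrite invg1 col_perm1 raddfB /= opprB.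
  have cd i : col_perm (tperm ord_max j) (delta_mx 0 i : 'rV[int]_m.+2) =
      delta_mx 0 (tperm ord_max j i).
    apply/rowP => l; rewrite !mxE; congr (_ && _)%:R.
    by apply/eqP/eqP => [<-|->]; rewrite tpermK.
  by rewrite !cd tpermL tpermD.
have trans (q : 'rV[int]_m.+2) : \sum_i q 0 i == 0 -> Gval 1%g q.
  move=> q0.
  have GD a b : Gval 1%g a -> Gval 1%g b -> Gval 1%g (a + b).
    by move=> Ga Gb; have := GvalM _ _ _ _ Ga Gb; rewrite mulg1 col_perm1.
  have GN a : Gval 1%g a -> Gval 1%g (- a).
    by move=> Ga; have := GvalV _ _ Ga; rewrite invg1 col_perm1.
  have GZ (z : int) a : Gval 1%g a -> Gval 1%g (z *: a).
    move=> Ga; have nat_case n : Gval 1%g (n%:R *: a : 'rV[int]_m.+2).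
      elim: n => [|n IH]; first by rewrite scale0r; apply: lin.
      by rewrite mulrS scalerDl scale1r; apply: GD.
    case: z => n; first by rewrite -[Posz n]natz; apply: nat_case.
    by rewrite NegzE -[Posz _]natz scaleNr; apply/GN/nat_case.
  have -> : q = \sum_j q 0 j *: (delta_mx 0 j - delta_mx 0 ord0).
    under eq_bigr do rewrite scalerBr.
    by rewrite sumrB -scaler_suml (eqP q0) scale0r subr0 -row_sum_delta.
  elim/big_ind: _ => [|a b|j _]; [exact: lin | exact: GD | exact: GZ].
move=> g.
have [h Gh hE] := GvalM _ _ _ _ (trans _ (aw_sum0 g)) (lin (aw_val g).1).
have <- // : h = g.
apply: val_inj; rewrite /= hE mul1g raddf0 addr0.
by rewrite [RHS]surjective_pairing.
Qed.

Lemma weyl_generated t (G : set (weyl t)) : is_subgroup G ->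
  (forall i, G (simple_refl i)) -> forall g, G g.
Proof.
case: t G => m G Gg Grefl g; last exact: affWeyl_generated.
apply: sym_generated => // i j ij.
have im : (i < m)%N by have := ltn_ord j; rewrite ij ltnS.
have := Grefl (Ordinal im); rewrite /simple_refl /=.
congr (G (tperm _ _)); apply: val_inj => //=.
Qed.

End WeylGeneration.

(** * Permutation representations as reflection representations *)

Section WeylReps.
Variable k : comNzRingType.
Hypothesis int_inj : injective (fun z : int => z%:~R : k).

(** This and [hcoef_fun] are the coordinates at the x_j and at ħ. Taking the latter to be 0 in
    finite type gives both types the same formulas. *)
Definition pcoef_fun t : 'I_(nverts t) -> perm_rep_of k t -> k :=
  match t with
  | FiniteType m => fun j (p : 'rV[k]_m.+1) => p 0 j
  | AffineType m => fun j (p : 'rV[k]_m.+2 * k^o) => p.1 0 j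
  end.

Fact pcoef_linear t j : linear_for *%R (@pcoef_fun t j).
Proof. by case: t j => m j a p q /=; rewrite !mxE. Qed.

HB.instance Definition _ t j := GRing.isLinear.Build k (perm_rep_of k t) k _
  (@pcoef_fun t j) (pcoef_linear j).

Definition pcoef t j : {scalar perm_rep_of k t} := @pcoef_fun t j.

Definition hcoef_fun t : perm_rep_of k t -> k :=
  match t with
  | FiniteType m => fun=> 0
  | AffineType m => fun (p : 'rV[k]_m.+2 * k^o) => p.2
  end.

Fact hcoef_linear t : linear_for *%R (@hcoef_fun t).
Proof. by case: t => m a p q /=; rewrite ?mulr0 ?addr0. Qed.

HB.instance Definition _ t := GRing.isLinear.Build k (perm_rep_of k t) k _
  (@hcoef_fun t) (@hcoef_linear t).

Definition hcoef t : {scalar perm_rep_of k t} := @hcoef_fun t.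

Definition is_edge0 t : 'I_(nedges t) -> bool :=
  match t with FiniteType m => fun=> false | AffineType m => fun i => i == ord0 end.

Definition proot t : 'I_(nedges t) -> perm_rep_of k t :=
  match t with
  | FiniteType m => fun i => (delta_mx 0 (@edge_src (FiniteType m) i) -
      delta_mx 0 (@edge_tgt (FiniteType m) i) : 'rV[k]_m.+1)
  | AffineType m => @aff_root k m
  end.

Lemma edge_src_tgt t (i : 'I_(nedges t)) : edge_src i != edge_tgt i.
Proof.
case: t i => m i; apply/eqP => /(congr1 val) /=.
  by rewrite /bump /=; lia.
case: i => [[|i] lt] /=; first by rewrite modn_small.
by rewrite modnDr modn_small; [lia | apply: ltnW].
Qed.

Lemma pcoef_root t (i : 'I_(nedges t)) j :
  pcoef j (proot i) = (j == edge_src i)%:R - (j == edge_tgt i)%:R.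
Proof.
case: t i j => m i j; rewrite /pcoef /=; first by rewrite !mxE.
rewrite /aff_root; case: (_ == ord0); first by rewrite !mxE addr0.
by rewrite !mxE addr0.
Qed.

Lemma hcoef_root t (i : 'I_(nedges t)) : hcoef t (proot i) = (is_edge0 i)%:R.
Proof.
case: t i => m i //; rewrite /hcoef /= /aff_root.
by case: (_ == ord0); rewrite /= subrr add0r.
Qed.

Lemma perm_rep_eq t (p q : perm_rep_of k t) :
  (forall j, pcoef j p = pcoef j q) -> hcoef t p = hcoef t q -> p = q.
Proof.
case: t p q => m p q pq hpq; first by apply/rowP => j; apply: pq.
case: p q pq hpq => [p1 p2] [q1 q2] /= pq hpq; congr pair => //.
by apply/rowP => j; apply: pq.
Qed.

Lemma pcoef_hbar t j : pcoef j (hbar k t) = 0.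
Proof. by case: t j => m j; rewrite /pcoef /= mxE. Qed.

Lemma hcoef_hbar t : hcoef t (hbar k t) = (is_affine t)%:R.
Proof. by case: t. Qed.

Lemma pcoef_refl t (i : 'I_(nedges t)) (p : perm_rep_of k t) j :
  pcoef j (ract (simple_refl i) p) =
  pcoef (tperm (edge_src i) (edge_tgt i) j) p.
Proof. by case: t i p j => m i p j; rewrite /pcoef /= mxE. Qed.

Lemma hcoef_refl t (i : 'I_(nedges t)) (p : perm_rep_of k t) :
  hcoef t (ract (simple_refl i) p) =
  hcoef t p - (pcoef (edge_src i) p - pcoef (edge_tgt i) p) * (is_edge0 i)%:R.
Proof.
case: t i p => m i p; rewrite /hcoef /pcoef /=; first by rewrite mulr0 subr0.
case: p => p z; rewrite /aff_act /=; case: eqP => [->|_]; last first.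
  by rewrite mulr0 big1 // => j _; rewrite mxE mul0r.
rewrite mulr1; congr (_ - _).
have pred0 : ord_pred ord0 = ord_max :> 'I_m.+2.
  by apply: val_inj; rewrite /= modn_small.
have E : (delta_mx 0 ord0 - delta_mx 0 ord_max : 'rV[int]_m.+2) =
    \row_j ((j == ord0)%:R - (j == ord_max)%:R).
  by apply/rowP => j; rewrite !mxE.
rewrite E (bigD1 ord0) //= (bigD1 ord_max) //= big1 => [|j /andP[/negPf j0 /negPf jm]].
  rewrite !mxE !eqxx pred0 tpermR tpermL.
  have -> : (ord0 == ord_max :> 'I_m.+2) = false by [].
  have -> : (ord_max == ord0 :> 'I_m.+2) = false by [].
  by rewrite subr0 sub0r rmorphN rmorph1 mul1r mulN1r addr0.
by rewrite !mxE j0 jm mul0r.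
Qed.

(** In this form the identities between reflections proved for V apply verbatim to the groups
    [weyl t]. *)
Lemma simple_refl_act t (i : 'I_(nedges t)) (p : perm_rep_of k t) :
  ract (simple_refl i) p =
  p - (pcoef (edge_src i) p - pcoef (edge_tgt i) p) *: proot i.
Proof.
apply: perm_rep_eq => [j|]; last first.
  by rewrite hcoef_refl raddfB /= scalarZ hcoef_root.
rewrite pcoef_refl raddfB /= scalarZ pcoef_root.
have ne := edge_src_tgt i.
case: tpermP => [->|->|/eqP/negPf -> /eqP/negPf ->].
- by rewrite eqxx (negPf ne) subr0 mulr1 opprB addrCA subrr addr0.
- by rewrite eqxx eq_sym (negPf ne) sub0r mulrN1 opprK addrCA subrr addr0.
- by rewrite subrr mulr0 subr0.
Qed.

Lemma perm_rep_faithful t (g g' : weyl t) :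
  (forall p : perm_rep_of k t, ract g p = ract g' p) -> g = g'.
Proof.
have perm_eq n (s s' : 'S_n) :
    (forall v : 'rV[k]_n, col_perm s v = col_perm s' v) -> s = s'.
  move=> ss'; apply/permP => j; have /rowP/(_ j) := ss' (delta_mx 0 (s j)).
  rewrite !mxE !eqxx /=; case: eqP => // _ /eqP; rewrite oner_eq0 //.
case: t g g' => m g g' gg'; first exact: perm_eq.
apply: val_inj; case: g g' gg' => [[s q] q0] [[s' q'] q0'] /= gg'.
have ss' : s = s'.
  by apply: perm_eq => v; have /(congr1 fst) := gg' (v, 0).
subst s'; congr pair; apply/rowP => j; apply: int_inj.
(* s carries the permuted basis vector back to the j-th one, so the ħ-coordinate of the image is
   minus the j-th entry of the translation. *)
have /(congr1 snd)/eqP := gg' (col_perm (s^-1)%g (delta_mx 0 j), 0).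
rewrite /= -!col_permM mulgV !col_perm1 !sub0r eqr_opp => /eqP.
have C (r : 'rV[int]_m.+2) :
    \sum_l (r 0 l)%:~R * (delta_mx 0 j : 'rV[k]_m.+2) 0 l = (r 0 j)%:~R.
  rewrite (bigD1 j) //= big1 ?addr0 => [|l /negPf lj]; first by rewrite mxE !eqxx mulr1.
  by rewrite mxE lj andbF mulr0.
by rewrite !C.
Qed.

Section PermMap.
Variables (M : lmodType k) (t : ctype) (x : 'I_(nverts t) -> M) (eta : M).

Definition perm_map (p : perm_rep_of k t) : M :=
  \sum_j pcoef j p *: x j + hcoef t p *: eta.

Fact perm_map_linear : linear perm_map.
Proof.
move=> a p q; rewrite /perm_map raddfD /= scalarZ scalerDl -scalerA.
rewrite scalerDr addrACA; congr (_ + _).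
rewrite scaler_sumr -big_split; apply: eq_bigr => j _ /=.
by rewrite raddfD /= scalarZ scalerDl scalerA.
Qed.

HB.instance Definition _ := GRing.isLinear.Build k (perm_rep_of k t) M _
  perm_map perm_map_linear.

Lemma perm_map_root (i : 'I_(nedges t)) : perm_map (proot i) =
  x (edge_src i) - x (edge_tgt i) + (is_edge0 i)%:R *: eta.
Proof.
rewrite /perm_map hcoef_root; congr (_ + _).
under eq_bigr do rewrite pcoef_root scalerBl; rewrite sumrB.
have pick (l : 'I_(nverts t)) : \sum_j (j == l)%:R *: x j = x l.
  by rewrite (bigD1 l) //= eqxx scale1r big1 ?addr0 // => j /negPf ->; rewrite scale0r.
by rewrite !pick.
Qed.

Lemma perm_map_hbar : perm_map (hbar k t) = (is_affine t)%:R *: eta.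
Proof.
rewrite /perm_map hcoef_hbar big1 ?add0r // => j _.
by rewrite pcoef_hbar scale0r.
Qed.

End PermMap.

(** The Cartan matrix in terms of endpoints. The rescaled roots of V have the same pairings, so the
    position of two edges in the graph determines the relation between their images in [weyl t]. *)
Definition root_pairing t (i j : 'I_(nedges t)) : k :=
  (edge_src i == edge_src j)%:R - (edge_src i == edge_tgt j)%:R -
  ((edge_tgt i == edge_src j)%:R - (edge_tgt i == edge_tgt j)%:R).

Let rform t (i : 'I_(nedges t)) : {scalar perm_rep_of k t} :=
  pcoef (edge_src i) \- pcoef (edge_tgt i).

Let rformE t (i j : 'I_(nedges t)) : rform i (proot j) = root_pairing i j.
Proof.
have -> : rform i (proot j) =
  pcoef (edge_src i) (proot j) - pcoef (edge_tgt i) (proot j) by [].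
by rewrite !pcoef_root.
Qed.

Lemma root_pairing2 t (i : 'I_(nedges t)) : root_pairing i i = 2.
Proof.
rewrite /root_pairing !eqxx [edge_tgt i == _]eq_sym (negPf (edge_src_tgt i)).
by rewrite subr0 sub0r opprK.
Qed.

Let act_form t (i : 'I_(nedges t)) (p : perm_rep_of k t) :
  ract (simple_refl i) p = p - rform i p *: proot i.
Proof. exact: simple_refl_act. Qed.

Lemma weyl_sq t (i : 'I_(nedges t)) : (simple_refl i * simple_refl i = 1)%g.
Proof.
apply: perm_rep_faithful => p; rewrite actM act1.
by apply: (refl_sq (act_form i)); rewrite rformE root_pairing2.
Qed.

Lemma weyl_commute t (i j : 'I_(nedges t)) :
    root_pairing i j = 0 -> root_pairing j i = 0 ->
  (simple_refl i * simple_refl j = simple_refl j * simple_refl i)%g.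
Proof.
move=> ij ji; apply: perm_rep_faithful => p; rewrite !actM.
by apply: (refl_commute (act_form i) (act_form j)); rewrite rformE.
Qed.

Lemma weyl_braid t (i j : 'I_(nedges t)) :
    root_pairing i j = root_pairing j i -> root_pairing i j * root_pairing i j = 1 ->
  (simple_refl i * simple_refl j * simple_refl i =
   simple_refl j * simple_refl i * simple_refl j)%g.
Proof.
move=> ij ji; apply: perm_rep_faithful => p; rewrite !actM.
by apply: (refl_braid (act_form i) (act_form j)); rewrite !rformE ?root_pairing2.
Qed.

End WeylReps.

(** * Normalized bases and projections *)

HB.instance Definition _ (k : comNzRingType) (W : groupType) (S : set W)
  (V : realization k S) (X : set V) := gen_eqMixin (component X).
HB.instance Definition _ (k : comNzRingType) (W : groupType) (S : set W)
  (V : realization k S) (X : set V) := gen_choiceMixin (component X).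

Section CtypeCombinatorics.
Variable t : ctype.
Implicit Types (i : 'I_(nedges t)) (j : 'I_(nverts t)).

Lemma edge_tgtS i : ~~ is_edge0 i -> edge_tgt i = (edge_src i).+1 :> nat.
Proof.
case: t i => m /= i; first by rewrite /bump.
case: i => [[|i] lt] //= _.
by rewrite modnDr modn_small // ltnW.
Qed.

Lemma edge0_src i j : is_edge0 i -> (j <= edge_src i)%N.
Proof.
case: t i j => m //= i j /eqP ->; rewrite /= modn_small //.
exact: (ltn_ord j).
Qed.

Lemma edge0_tgt i : is_edge0 i -> edge_tgt i = 0%N :> nat.
Proof. by case: t i => m //= i /eqP ->. Qed.

Lemma edge0_uniq i i' : is_edge0 i -> is_edge0 i' -> i = i'.
Proof. by case: t i i' => m //= i i' /eqP -> /eqP ->. Qed.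

Lemma edge_tgt_inj : injective (@edge_tgt t).
Proof. by case: t => m /= i i' //; apply: lift_inj. Qed.

Lemma edge_tgt_gt0 i : ~~ is_edge0 i -> (0 < edge_tgt i)%N.
Proof. by move/edge_tgtS ->. Qed.

Variables (k : comNzRingType) (M : lmodType k).
Variables (x : 'I_(nverts t) -> M) (off : 'I_(nedges t) -> M).

Definition shifted_vert j : M :=
  x j + \sum_(i | ~~ is_edge0 i && (edge_tgt i <= j)%N) off i.

Definition total_shift : M := - \sum_i off i.

(* Sliding x_j by the accumulated offsets makes every edge but the 0-th one an
   honest swap; the 0-th one picks up the holonomy of the cycle. *)
Lemma shifted_root i : x (edge_src i) - x (edge_tgt i) - off i =
  perm_map shifted_vert total_shift (proot k i).
Proof.
rewrite perm_map_root /shifted_vert.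
have [i0|i0] := boolP (is_edge0 i).
  (* The edge 0 runs from the last vertex, shifted by every other offset, to the initial vertex,
     which is not shifted. *)
  have -> : total_shift = - off i - \sum_(l | l != i) off l.
    by rewrite /total_shift (bigD1 i) //= opprD.
  rewrite scale1r [X in x (edge_tgt i) + X]big1 ?addr0; last first.
    by move=> l /andP[/edge_tgt_gt0 l0]; rewrite (edge0_tgt i0) leqNgt l0.
  rewrite (eq_bigl (fun l => l != i)); last first.
    move=> l; rewrite (edge0_src _ i0) andbT.
    apply/idP/idP => [l0|]; first by apply: contraNneq l0 => ->.
    by apply: contraNN => l0; apply/eqP/edge0_uniq.
  by rewrite !addrA [RHS](ACl (1*3*4*(2*5))) /= subrr addr0.
rewrite scale0r addr0 (edge_tgtS i0).
rewrite [X in _ - (_ + X)](bigD1 i) /=; last by rewrite i0 (edge_tgtS i0) leqnn.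
rewrite [X in _ - (_ + (_ + X))](eq_bigl
  (fun l => ~~ is_edge0 l && (edge_tgt l <= edge_src i)%N)); last first.
  move=> l; rewrite -andbA; congr (_ && _).
  rewrite leq_eqVlt ltnS -(edge_tgtS i0).
  have [->|li] := eqVneq l i; first by rewrite (edge_tgtS i0) ltnn andbF.
  rewrite andbT orbC; case: leqP => //= _; apply/eqP => E.
  by case/eqP: li; apply: edge_tgt_inj; apply: val_inj.
by rewrite !opprD !addrA [RHS](ACl (1*3*4*(2*5))) /= subrr addr0.
Qed.

End CtypeCombinatorics.

(** * Maps from the permutation representations to V, and projections of W *)

Section ProductDecomposition.
Variables (k : comNzRingType) (W : groupType) (S : set W).
Variables (V : realization k S) (X H : set V) (xi : V -> {scalar V}).
Hypothesis D : orthant_coords X H xi.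
Hypothesis faithful : faithful_rep V.
Hypothesis cox : coxeter_system S.
Variable L : forall C : component X, labelling C.
Implicit Types C : component X.

Definition lvert C (j : 'I_(nverts (L C))) : V := vert j.
Definition ledge C (i : 'I_(nedges (L C))) : S := edge i.

Lemma lvert_inj C : injective (@lvert C).
Proof.
have [_ inj _] := vert_bij (L C).
by move=> j l; apply: inj; apply: mem_set.
Qed.

Lemma lvert_C C j : sval C (@lvert C j).
Proof. by have [sub _ _] := vert_bij (L C); apply: sub. Qed.

Lemma lvert_X C j : X (@lvert C j).
Proof. exact: (comp_sub (lvert_C j)). Qed.

Lemma lvert_surj C x : sval C x -> exists j, lvert (C := C) j = x.
Proof. by have [_ _ sur] := vert_bij (L C); move/sur => [j _ <-]; exists j. Qed.

Lemma ledge_inj C : injective (@ledge C).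
Proof.
have [_ inj _] := edge_bij (L C).
by move=> j l; apply: inj; apply: mem_set.
Qed.

Lemma ledge_C C i : edges_in C (@ledge C i).
Proof. by have [sub _ _] := edge_bij (L C); apply: sub. Qed.

Lemma ledge_surj C s : edges_in C s -> exists i, ledge (C := C) i = s.
Proof. by have [_ _ sur] := edge_bij (L C); move/sur => [j _ <-]; exists j. Qed.

Lemma comp_inj C C' x : sval C x -> sval C' x -> C = C'.
Proof.
move=> Cx C'x.
have sub (A B : component X) : sval A x -> sval B x -> sval A `<=` sval B.
  move=> Ax Bx y Ay.
  apply: (comp_closed_full (Q := sval B) Ax Bx _ Ay) => s u z _ Bu.
  exact: comp_joins Bu.
have E : sval C = sval C' by apply/seteqP; split; apply: sub.
case: C C' Cx C'x E => [A PA] [B PB] /= _ _ E.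
by subst B; congr exist; apply: Prop_irrelevance.
Qed.

Lemma comp_of x : X x -> exists C, sval C x.
Proof.
move=> Xx; exists (exist _ [set y | connected_to X x y] (ex_intro2 _ _ x Xx erefl)).
exact: connected_refl.
Qed.

Lemma edges_in_vertex C s x y h : edge_at X H xi s x y h -> edges_in C s ->
  sval C x.
Proof. by move=> e [_ sub]; apply: sub; rewrite (edge_moved D e); left. Qed.

Lemma vertex_edges_in C s x y h : edge_at X H xi s x y h -> sval C x ->
  edges_in C s.
Proof. by move=> e Cx; apply: joins_edges_in (edge_joins_xy D e) Cx. Qed.

Lemma edges_in_inj C C' s : edges_in C s -> edges_in C' s -> C = C'.
Proof.
have [x [y [h e]]] := edge_exists D s => Cs C's.
exact: (comp_inj (edges_in_vertex e Cs) (edges_in_vertex e C's)).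
Qed.

Lemma edges_in_exists s : exists C, edges_in C s.
Proof.
have [x [y [h e]]] := edge_exists D s; have [Xx _ _ _ _] := e.
have [C Cx] := comp_of Xx; exists C; exact: (vertex_edges_in e Cx).
Qed.

(** The h of [edge_at], recovered from the action so that nothing has to be chosen. *)
Definition offset C (i : 'I_(nedges (L C))) : V :=
  ract (val (ledge i)) (lvert (edge_src i)) - lvert (edge_tgt i).

Lemma ledge_at C (i : 'I_(nedges (L C))) : edge_at X H xi (ledge i)
  (lvert (edge_src i)) (lvert (edge_tgt i)) (offset i).
Proof.
have [h e] := joins_edge D (edge_joins i).
suff -> : offset i = h by [].
by rewrite /offset (edge_l D e) addrAC subrr add0r.
Qed.

Definition scaled_root C (i : 'I_(nedges (L C))) : V :=
  lvert (edge_src i) - lvert (edge_tgt i) - offset i.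

Definition nvert C := shifted_vert (@lvert C) (@offset C).
Arguments nvert C j : clear implicits.
Definition holonomy C := total_shift (@offset C).
Definition phi C : {linear perm_rep_of k (L C) -> V} :=
  perm_map (nvert C) (holonomy C).

Arguments phi C : clear implicits.

Lemma phi_root C i : phi C (proot k i) = scaled_root i.
Proof. exact/esym/shifted_root. Qed.

Lemma offset_H C i : zspan H (@offset C i).
Proof. by have [] := ledge_at i. Qed.

Lemma holonomy_H C : zspan H (holonomy C).
Proof. by apply/lspanN/lspan_sum => i _; apply: offset_H. Qed.

Lemma nvert_shift C j : exists2 h, zspan H h & nvert C j = lvert j + h.
Proof.
rewrite /nvert /shifted_vert.
exists (\sum_(i | ~~ is_edge0 i && (edge_tgt i <= j)%N) @offset C i) => //.
by apply: lspan_sum => i _; apply: offset_H.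
Qed.

Lemma xi_nvert C j x : X x -> xi x (nvert C j) = (x == lvert j)%:R.
Proof.
move=> Xx; have [h hH ->] := nvert_shift j.
rewrite raddfD /= (xi_spanH D Xx hH) addr0 (xi_X D) //; exact: lvert_X.
Qed.

Lemma xi_phi_out C x (p : perm_rep_of k (L C)) : X x -> ~ sval C x ->
  xi x (phi C p) = 0.
Proof.
move=> Xx nCx; rewrite /phi /= /perm_map raddfD raddf_sum /= scalarZ.
rewrite (xi_spanH D Xx (holonomy_H C)) mulr0 addr0 big1 // => j _.
rewrite scalarZ xi_nvert //; case: eqP => [xj|_]; last by rewrite mulr0.
by case: nCx; rewrite xj; apply: lvert_C.
Qed.

Lemma xi_phi C (j : 'I_(nverts (L C))) (p : perm_rep_of k (L C)) :
  xi (lvert j) (phi C p) = pcoef k j p.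
Proof.
rewrite /phi /= /perm_map raddfD raddf_sum /= scalarZ.
rewrite (xi_spanH D (lvert_X j) (holonomy_H C)) mulr0 addr0 (bigD1 j) //=.
rewrite scalarZ xi_nvert ?eqxx ?mulr1; last exact: lvert_X.
rewrite big1 ?addr0 // => l lj.
rewrite scalarZ xi_nvert; last exact: lvert_X.
by rewrite (inj_eq (@lvert_inj C)) eq_sym (negPf lj) mulr0.
Qed.

(** Offsets lie in Span H, so [phi] preserves the coordinates at the vertices of C. Both reflections
    thus subtract the same multiple of corresponding roots. *)
Lemma phi_simple C (i : 'I_(nedges (L C))) p :
  phi C (ract (simple_refl i) p) = ract (val (ledge i)) (phi C p).
Proof.
have [_ _ _ _ ->] := ledge_at i.
by rewrite simple_refl_act raddfB /= linearZ /= phi_root !xi_phi.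
Qed.

Lemma phi_other C s p : ~ edges_in C s -> ract (val s) (phi C p) = phi C p.
Proof.
move=> nCs; have [x [y [h e]]] := edge_exists D s.
have [Xx Xy _ _ ->] := e.
rewrite (xi_phi_out _ Xx) ?(xi_phi_out _ Xy) ?subrr ?scale0r ?subr0 //.
  by move=> Cy; apply: nCs; apply: vertex_edges_in (edge_sym e) Cy.
by move=> Cx; apply: nCs; apply: vertex_edges_in e Cx.
Qed.

Lemma root_pairingE C (i j : 'I_(nedges (L C))) : root_pairing k i j =
  edge_form xi (lvert (edge_src i)) (lvert (edge_tgt i)) (scaled_root j).
Proof.
rewrite (edge_pairing D (ledge_at i) (ledge_at j)) /root_pairing.
by rewrite !(inj_eq (@lvert_inj C)).
Qed.

Lemma root_pairingC C (i j : 'I_(nedges (L C))) :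
  root_pairing k i j = root_pairing k j i.
Proof.
rewrite /root_pairing ![edge_src j == _]eq_sym ![edge_tgt j == _]eq_sym.
by rewrite !opprB !addrA [RHS](ACl (1*4*3*2)).
Qed.

(** A labelling fixes the direction of each edge, so the shared vertex may be a source or a target;
    the sign of the pairing varies over the four cases, but its square does not. *)
Lemma share_pairing_sq s t z x y h x' y' h' :
    edge_at X H xi s x y h -> edge_at X H xi t x' y' h' ->
    moved X s `&` moved X t = [set z] ->
  edge_form xi x y (x' - y' - h') * edge_form xi x y (x' - y' - h') = 1.
Proof.
move=> es et st; have [_ _ /eqP xy _ _] := es; have [_ _ /eqP xy' _ _] := et.
rewrite (edge_pairing D es et).
rewrite (edge_moved D es) (edge_moved D et) in st.
have [zs zt] : ([set x; y] `&` [set x'; y']) z by rewrite st.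
have N u v : [set x; y] u -> [set x'; y'] v -> u = v -> u = z.
  move=> su tu uv; suff : ([set x; y] `&` [set x'; y']) u by rewrite st.
  by split=> //; rewrite uv.
have F u v : [set x; y] u -> [set x'; y'] v -> u != z -> (u == v) = false.
  by move=> su tu uz; apply/eqP => uv; rewrite (N u v su tu uv) eqxx in uz.
have xs : [set x; y] x by left.
have ys : [set x; y] y by right.
have xt : [set x'; y'] x' by left.
have yt : [set x'; y'] y' by right.
case: zs zt => /= zE [] /= zE'.
- rewrite -zE -zE' in xy xy' N F xs ys xt yt *.
  have yz : y != z by rewrite eq_sym.
  rewrite eqxx (negPf xy') (F y z ys xt yz) (F y y' ys yt yz).
  by rewrite /=; ring.
- rewrite -zE -zE' in xy xy' N F xs ys xt yt *.
  have yz : y != z by rewrite eq_sym.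
  rewrite eqxx [z == x']eq_sym (negPf xy') (F y x' ys xt yz) (F y z ys yt yz).
  by rewrite /=; ring.
- rewrite -zE -zE' in xy xy' N F xs ys xt yt *.
  rewrite eqxx (negPf xy') (F x z xs xt) // (F x y' xs yt) //.
  by rewrite /=; ring.
- rewrite -zE -zE' in xy xy' N F xs ys xt yt *.
  rewrite eqxx [z == x']eq_sym (negPf xy') (F x z xs yt) // (F x x' xs xt) //.
  by rewrite /=; ring.
Qed.

(** Edges outside C go to 1. Edges with a common vertex lie in the same component, so a braid
    relation never mixes a reflection with 1. *)
Lemma projection_exists C : exists pr : UMagmaMorphism.type W (weyl (L C)),
  (forall i, pr (val (ledge i)) = simple_refl i) /\
  (forall s : S, ~ edges_in C s -> pr (val s) = 1%g).
Proof.
have fE s : exists g : weyl (L C),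
    (forall i, ledge i = s -> g = simple_refl i) /\ (~ edges_in C s -> g = 1%g).
  have [Cs|nCs] := pselect (edges_in C s).
    have [i <-] := ledge_surj Cs.
    by exists (simple_refl i); split=> [j /ledge_inj ->|[]] //; apply: ledge_C.
  by exists 1%g; split=> // i si; exfalso; apply: nCs; rewrite -si; apply: ledge_C.
have [f fP] := choice fE.
have f_edge i : f (ledge i) = simple_refl i by have [/(_ i erefl) ->] := fP (ledge i).
have f_out s : ~ edges_in C s -> f s = 1%g by have [_] := fP s.
have [|s t st|s t z st|F FM FS] := @coxeter_lift _ _ _ _ _ _ _ D faithful cox _ f.
- move=> s; have [Cs|nCs] := pselect (edges_in C s); last by rewrite f_out ?mulg1.
  have [i <-] := ledge_surj Cs; rewrite f_edge; exact: (weyl_sq (int_inj D)).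
- have [Cs|nCs] := pselect (edges_in C s); last by rewrite (f_out s) ?mulg1 ?mul1g.
  have [Ct|nCt] := pselect (edges_in C t); last by rewrite (f_out t) ?mulg1 ?mul1g.
  have [i si] := ledge_surj Cs; have [j jt] := ledge_surj Ct; subst s t.
  rewrite !f_edge; have ij : root_pairing k i j = 0.
    by rewrite root_pairingE (disjoint_pairing D (ledge_at i) (ledge_at j)).
  by apply: (weyl_commute (int_inj D)) => //; rewrite root_pairingC.
- have [x [y [h [h' [es et _]]]]] := share_edges D st.
  have [Cs|nCs] := pselect (edges_in C s); last first.
    have nCt : ~ edges_in C t.
      by move=> Ct; apply: nCs; apply: vertex_edges_in es (edges_in_vertex et Ct).
    by rewrite !f_out.
  have Ct : edges_in C t := vertex_edges_in et (edges_in_vertex es Cs).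
  have [i si] := ledge_surj Cs; have [j jt] := ledge_surj Ct; subst s t.
  rewrite !f_edge; apply: (weyl_braid (int_inj D)); first exact: root_pairingC.
  by rewrite root_pairingE; apply: share_pairing_sq (ledge_at i) (ledge_at j) st.
have Fg : {morph F : x y / (x * y^-1)%g}.
  have F1 : F 1%g = 1%g by apply: (mulgI (F 1%g)); rewrite -FM !mulg1.
  move=> x y; rewrite FM; congr (_ * _)%g; apply: (mulIg (F y)).
  by rewrite -FM !mulVg.
exists (HB.pack_for (UMagmaMorphism.type W (weyl (L C))) F
  (isGroupMorphism.Build _ _ F Fg)).
by split=> [i|s nCs] /=; rewrite FS ?f_edge ?f_out.
Qed.

End ProductDecomposition.

(** * The product decomposition *)

Section Decomposed.
Variables (k : comNzRingType) (W : groupType) (S : set W).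
Variables (V : realization k S) (X H : set V) (xi : V -> {scalar V}).
Hypothesis D : orthant_coords X H xi.
Hypothesis faithful : faithful_rep V.
Hypothesis cox : coxeter_system S.
Hypothesis hfin : finite_set S \/ finite_set X.
Variable L : forall C : component X, labelling C.
Implicit Types C : component X.
Variable pr : forall C, UMagmaMorphism.type W (weyl (L C)).
Hypothesis pr_edge : forall C i, pr C (val (ledge (L := L) (C := C) i)) = simple_refl i.
Hypothesis pr_out : forall C (s : S), ~ edges_in C s -> pr C (val s) = 1%g.

Lemma generated_ind (A : set W) : is_subgroup A -> (forall s : S, A (val s)) ->
  forall w, A w.
Proof.
move=> Ag AS w; have [_ gen _] := cox.
have : subgroup_generated S w by rewrite gen.
by apply=> // v Sv; have := AS (SigSub (mem_set Sv)).
Qed.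

Lemma phi_equivariant C w (p : perm_rep_of k (L C)) :
  phi L C (ract (pr C w) p) = ract w (phi L C p).
Proof.
move: p; pattern w; move: w; apply: generated_ind.
  split=> [p|u w Au Aw p|w Aw p]; first by rewrite gmulf1 !act1.
    by rewrite gmulfM !actM Au Aw.
  have := Aw (ract (pr C w^-1%g) p); rewrite -actM -gmulfM mulgV gmulf1 act1 => ->.
  by rewrite -actM mulVg act1.
move=> s p; have [Cs|nCs] := pselect (edges_in C s).
  by have [i <-] := ledge_surj L Cs; rewrite pr_edge; apply: (phi_simple D).
by rewrite pr_out // act1 (phi_other D).
Qed.

Definition pvert t : 'I_(nverts t) -> perm_rep_of k t :=
  match t with
  | FiniteType m => fun j => (delta_mx 0 j : 'rV[k]_m.+1)
  | AffineType m => @aff_x k m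
  end.

Lemma pcoef_pvert t (j l : 'I_(nverts t)) : pcoef k j (pvert l) = (j == l)%:R.
Proof. by case: t j l => m j l; rewrite /pcoef /= !mxE. Qed.

Lemma hcoef_pvert t (l : 'I_(nverts t)) : hcoef k t (pvert l) = 0.
Proof. by case: t l. Qed.

Lemma phi_pvert C j : phi L C (pvert j) = nvert j.
Proof.
rewrite /phi /= /perm_map hcoef_pvert scale0r addr0 (bigD1 j) //= pcoef_pvert.
rewrite eqxx scale1r big1 ?addr0 // => l /negPf lj.
by rewrite pcoef_pvert lj scale0r.
Qed.

Lemma vertex_decomp x : X x -> exists C j h, zspan H h /\ x = phi L C (@pvert (L C) j) + h.
Proof.
move=> Xx; have [C Cx] := comp_of Xx; have [j <-] := lvert_surj L Cx.
have [h hH hE] := nvert_shift D j.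
exists C, j, (- h); split; first exact: lspanN.
by rewrite phi_pvert hE addrK.
Qed.

Lemma pr_inj w w' : (forall C, pr C w = pr C w') -> w = w'.
Proof.
move=> ww'; apply: (faithful_eq faithful) => v.
apply: (lspan_ind (P := fun v => ract w v = ract w' v)) (spanXH D v).
- have actH h : zspan H h -> ract w h = ract w' h.
    by move=> hH; rewrite !(act_spanH D _ hH).
  have actD u x y : ract u (x + y) = ract u x + ract u y :> V.
    by have := act_linear u 1 x y; rewrite !scale1r.
  move=> b [Xb|Hb]; last by rewrite !(Hinv D Hb).
  have [C [j [h [hH ->]]]] := vertex_decomp Xb.
  rewrite (actD w (phi L C _) h) (actD w' (phi L C _) h) -!phi_equivariant.
  by rewrite ww' actH.
- by move=> a u u' wu wu'; rewrite !act_linear wu wu'.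
- by rewrite !act0.
Qed.

Lemma is_subgroup_ker C : is_subgroup [set w | pr C w = 1%g].
Proof.
split=> [|x y|x] /=; first exact: gmulf1.
  by rewrite gmulfM => -> ->; rewrite mulg1.
by rewrite gmulfV => ->; rewrite invg1.
Qed.

Lemma pr_parabolic_other C C' w : parabolic C w -> C <> C' -> pr C' w = 1%g.
Proof.
move=> Cw CC'; apply: Cw (is_subgroup_ker C') _ => _ [s Cs ->] /=.
by apply: pr_out => C's; apply: CC'; apply: (edges_in_inj D) Cs C's.
Qed.

Lemma parabolic_subgroup C : is_subgroup (parabolic C).
Proof.
split=> [G [] //|x y Cx Cy G Gg GS|x Cx G Gg GS].
  by have [_ GM _] := Gg; apply: GM; [apply: Cx | apply: Cy].
by have [_ _ GV] := Gg; apply: GV; apply: Cx.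
Qed.

Lemma pr_parabolic_surj C g : exists2 w, parabolic C w & pr C w = g.
Proof.
pose A : set (weyl (L C)) := [set g | exists2 w, parabolic C w & pr C w = g].
have [P1 PM PV] := parabolic_subgroup C.
apply: (weyl_generated (G := A)) => [|i].
  split=> [|x y [u Cu <-] [w Cw <-]|x [u Cu <-]].
  - by exists 1%g => //; apply: gmulf1.
  - by exists (u * w)%g; [apply: PM | apply: gmulfM].
  - by exists (u^-1)%g; [apply: PV | apply: gmulfV].
exists (val (ledge (L := L) i)); last exact: pr_edge.
by move=> G _; apply; exists (ledge (L := L) i) => //; apply: ledge_C.
Qed.

(** Such components are images of edges, and all components are images of vertices, so finiteness of
    either S or X is enough. [C0] is a default value for the choice functions. *)
Lemma finite_edged : finite_set [set C : component X | exists s, edges_in C s].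
Proof.
have [[C0]|nC] := pselect (inhabited (component X)); last first.
  rewrite (_ : [set C | _] = set0) //; apply/seteqP; split=> // C _.
  by case: nC; constructor.
have [Sfin|Xfin] := hfin.
  have cE w : exists C : component X, forall s : S, val s = w -> edges_in C s.
    have [Sw|nSw] := pselect (S w); last first.
      by exists C0 => s sw; case: nSw; rewrite -sw; apply: set_valP.
    have [C Cs] := edges_in_exists D (SigSub (mem_set Sw)).
    by exists C => s sw; rewrite (_ : s = SigSub (mem_set Sw)) //; apply: val_inj.
  have [c cP] := choice cE; apply: sub_finite_set (finite_image c Sfin) => C [s Cs].
  exists (val s); first exact: set_valP.
  exact: (edges_in_inj D) (cP _ s erefl) Cs.
have cE x : exists C : component X, X x -> sval C x.
  have [Xx|nXx] := pselect (X x); last by exists C0.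
  by have [C Cx] := comp_of Xx; exists C.
have [c cP] := choice cE; apply: sub_finite_set (finite_image c Xfin) => C _.
have [x Cx] := comp_nonempty C; have Xx := comp_sub Cx.
by exists x => //; apply: comp_inj (cP x Xx) Cx.
Qed.

Lemma edgeless_weyl C : ~ (exists s, edges_in C s) -> forall g : weyl (L C), g = 1%g.
Proof.
move=> nC; apply: (weyl_generated (G := [set 1%g])) => [|i].
  by split=> [//|x y -> ->|x ->] /=; rewrite ?mulg1 ?invg1.
by case: nC; exists (ledge (L := L) i); apply: ledge_C.
Qed.

Lemma edgeless_parabolic C : ~ (exists s, edges_in C s) -> parabolic C = [set 1%g].
Proof.
move=> nC; apply/seteqP; split=> w /=; last by move=> ->; have [] := parabolic_subgroup C.
move=> Cw; apply: (Cw [set 1%g]).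
  by split=> [//|x y -> ->|x ->] /=; rewrite ?mulg1 ?invg1.
by move=> v [s Cs _]; case: nC; exists s.
Qed.

(** A finite product of lifts taken in the parabolic subgroups works: each lift is killed by the
    other projections, and a component without edges has a trivial group. *)
Lemma pr_surj (g : forall C, weyl (L C)) : exists w, forall C, pr C w = g C.
Proof.
have [u uP] : exists u : forall C : component X, W,
    forall C, parabolic C (u C) /\ pr C (u C) = g C.
  have uE C : exists u : W, parabolic C u /\ pr C u = g C.
    by have [w Cw wg] := pr_parabolic_surj (g C); exists w.
  by have [u uP] := choice uE; exists u.
have /finite_seqP[r rE] := finite_edged.
have [w [wr wn]] : exists w, (forall C, C \in r -> pr C w = g C) /\
    (forall C, C \notin r -> pr C w = 1%g).
  elim: (r) => [|C s [w [ws wn]]]; first by exists 1%g; split=> // C _; apply: gmulf1.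
  have [Cs|Cs] := boolP (C \in s).
    exists w; split=> C'; rewrite inE.
      by move=> /predU1P[->|]; apply: ws.
    by rewrite negb_or => /andP[_]; apply: wn.
  exists (u C * w)%g; have [Cu ug] := uP C; split=> C'.
    rewrite inE gmulfM; have [->|CC'] := eqVneq C' C.
      by rewrite ug wn // mulg1.
    move=> /= C's; rewrite ws // (pr_parabolic_other Cu) ?mul1g //.
    by apply/eqP; rewrite eq_sym.
  rewrite inE negb_or gmulfM => /andP[/eqP CC' C's].
  by rewrite wn // mulg1 (pr_parabolic_other Cu) //; apply: nesym.
exists w => C; have [Cr|Cr] := boolP (C \in r); first exact: wr.
rewrite wn // [RHS]edgeless_weyl // => Cs.
have : [set` r] C by rewrite -rE.
by rewrite /= (negPf Cr).
Qed.

Lemma product_decomposition_of_projections : product_decomposition pr.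
Proof.
split.
- exact: pr_edge.
- exact: pr_out.
- have [inv invP] := choice pr_surj.
  exists (fun g => inv g) => [w|g].
    by apply: pr_inj => C; rewrite invP.
  by apply: functional_extensionality_dep => C; rewrite invP.
- move=> C; split=> [//|w w' /set_mem Cw /set_mem Cw' ww'|g _].
    apply: pr_inj => C'; have [<- //|/eqP CC'] := eqVneq C C'.
    by rewrite (pr_parabolic_other Cw CC') (pr_parabolic_other Cw' CC').
  by have [w Cw <-] := pr_parabolic_surj g; exists w.
- apply: sub_finite_set finite_edged => C /= nC; apply: contrapT => nE.
  by apply: nC; apply: edgeless_parabolic.
Qed.

End Decomposed.

(** * Balanced scalings of the simple roots *)

Section Balanced.
Variables (k : comNzRingType) (W : groupType) (S : set W).
Variables (V : realization k S) (X H : set V) (xi : V -> {scalar V}).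
Hypothesis D : orthant_coords X H xi.
Variable L : forall C : component X, labelling C.
Implicit Types C : component X.

Lemma fsbig_edges C (F : S -> V) :
  \sum_(s \in edges_in C) F s = \sum_i F (ledge (L := L) (C := C) i).
Proof.
rewrite (reindex_fsbig (@ledge _ _ _ _ _ L C) setT); last exact: edge_bij.
rewrite (fsbigE (index_enum _)) ?index_enum_uniq //.
  by apply: eq_bigl => i; rewrite in_setT.
by move=> i _; rewrite mem_index_enum.
Qed.

Lemma sum_proot t : is_affine t -> \sum_i proot k i = hbar k t.
Proof. by case: t => // m _; apply: sum_aff_root. Qed.

Lemma phi_hbar C : phi L C (hbar k (L C)) = (is_affine (L C))%:R *: holonomy L C.
Proof. exact: perm_map_hbar. Qed.

(** The image under [phi] of the identity that the simple roots of P_C add up to ħ. *)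
Lemma sum_scaled_root C : is_affine (L C) ->
  \sum_i scaled_root (L := L) (C := C) i = holonomy L C.
Proof.
move=> aff; transitivity (phi L C (\sum_i proot k i)).
  by rewrite raddf_sum; apply: eq_bigr => i _ /=; rewrite -phi_root.
by rewrite sum_proot // phi_hbar aff scale1r.
Qed.

Lemma root_scaling C (i : 'I_(nedges (L C))) :
  let al : V := simple_root V (ledge i) in
  simple_coroot V (ledge i) (lvert (edge_src i)) * xi (lvert (edge_src i)) al = 1 /\
  al = xi (lvert (edge_src i)) al *: scaled_root i.
Proof. exact: (edge_root D (ledge_at D i)). Qed.

(** The value of the coroot at the source of its edge is a unit that rescales the simple root to
    [scaled_root]; around a cycle these add up to the holonomy, which lies in Span_Z H. *)
Lemma balanced_exists : exists u : S -> k, balanced_scaling H L u.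
Proof.
have uE s : exists u : k, (exists c, c * u = 1) /\
    forall C (i : 'I_(nedges (L C))), ledge i = s ->
      u *: simple_root V s = scaled_root i.
  have [C Cs] := edges_in_exists D s; have [i si] := ledge_surj L Cs.
  have [cq al] := root_scaling i.
  exists (simple_coroot V s (lvert (edge_src i))); split.
    by exists (xi (lvert (edge_src i)) (simple_root V s)); rewrite mulrC -si.
  move=> C' i' i's; have CC' : C' = C.
    by apply: (edges_in_inj D (s := s)) Cs; rewrite -i's; apply: ledge_C.
  subst C'; have -> : i' = i by apply: (@ledge_inj _ _ _ _ _ L C); rewrite i's.
  by rewrite -si [in LHS]al scalerA cq scale1r.
have [u uP] := choice uE; exists u; split=> [s|C aff]; first by have [] := uP s.
rewrite fsbig_edges (eq_bigr (@scaled_root _ _ _ _ _ L C)).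
  by rewrite sum_scaled_root //; apply: (holonomy_H D).
by move=> i _; have [_ /(_ C i erefl) ->] := uP (ledge i).
Qed.

End Balanced.

(** * The isomorphism *)

Section QuotientIso.
Local Open Scope quotient_scope.
Variables (k : pzRingType) (W : groupType) (U V : rep k W).
Variables (B : set U) (Binv : B `<=` invariants U) (f : {linear U -> V}).
Hypothesis f_act : forall w u, f (ract w u) = ract w (f u).
Hypothesis f_surj : forall v, exists u, f u = v.
Hypothesis f_ker : forall u, f u = 0 <-> lspan B u.

(** The first isomorphism theorem, in the direction from V: a vector goes to the class of a chosen
    preimage, which does not depend on the choice. *)
Lemma rep_iso_quot : rep_iso V (quot_rep Binv).
Proof.
have [g gK] := choice f_surj.
pose h (v : V) : quot_rep Binv := \pi_(lquot B) (g v).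
have pi_eq (u u' : U) : f u = f u' -> \pi_(lquot B) u = \pi_(lquot B) u'.
  move=> uu'; apply/eqP/lquot_eqP; apply/f_ker.
  by rewrite raddfB /= uu' subrr.
have h_lin : linear h.
  move=> a v v'; rewrite /h.
  transitivity (\pi_(lquot B) (a *: g v + g v')).
    by apply: pi_eq; rewrite linearP /= !gK.
  by rewrite lquotD lquotZ.
exists (HB.pack_for {linear V -> quot_rep Binv} h
  (GRing.isLinear.Build _ _ _ _ h h_lin)); split.
  exists (fun q : lquot B => f (repr q)) => [v|q] /=.
    rewrite -[RHS]gK; apply/eqP; rewrite -subr_eq0 -raddfB; apply/eqP/f_ker.
    exact: lquot_repr.
  transitivity (\pi_(lquot B) (repr q)); last exact: reprK.
  by apply: pi_eq; rewrite gK.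
move=> w v; transitivity (\pi_(lquot B) (ract w (g v))).
  by apply: pi_eq; rewrite gK f_act gK.
exact/esym/(quot_act_pi Binv).
Qed.

End QuotientIso.

Section DirectSumMap.
Variables (A : pzRingType) (I : choiceType) (M : I -> lmodType A) (N : lmodType A).
Variable g : forall i, {linear M i -> N}.

Definition dsum_map_to (f : dsum M) : N := \sum_(i \in [set: I]) g i (f i).

Lemma dsum_map_toE (f : dsum M) (r : seq I) : uniq r ->
  (forall i, i \notin r -> f i = 0) -> dsum_map_to f = \sum_(i <- r) g i (f i).
Proof.
move=> ru f0; rewrite /dsum_map_to (fsbigE r) //.
  by apply: eq_bigl => i; rewrite in_setT.
by move=> i _ ir; rewrite f0 // raddf0.
Qed.

Lemma dsum_support (f : dsum M) : exists r : seq I,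
  uniq r /\ forall i, i \notin r -> f i = 0.
Proof.
have /finite_seqP[r rE] := dsum_finite f.
exists (undup r); split=> [|i]; first exact: undup_uniq.
rewrite mem_undup => ir; apply: contrapT => fi.
have : [set` r] i by rewrite -rE.
by rewrite /= (negPf ir).
Qed.

Fact dsum_map_to_linear : linear dsum_map_to.
Proof.
move=> a f f'; have [r [ru r0]] := dsum_support f.
have [r' [ru' r0']] := dsum_support f'.
pose s := undup (r ++ r').
have s0 i : i \notin s -> f i = 0 /\ f' i = 0.
  by rewrite mem_undup mem_cat negb_or => /andP[/r0 -> /r0' ->].
rewrite !(@dsum_map_toE _ s) ?undup_uniq //.
- rewrite scaler_sumr -big_split /=; apply: eq_bigr => i _.
  exact: (linearP (g i) a (f i) (f' i)).
- by move=> i /s0[].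
- by move=> i /s0[].
- by move=> i /s0[fi f'i]; change (a *: f i + f' i = 0); rewrite fi f'i scaler0 addr0.
Qed.

HB.instance Definition _ := GRing.isLinear.Build A (dsum M) N _
  dsum_map_to dsum_map_to_linear.

Lemma dsum_injE i (m : M i) : dsum_inj m i = m.
Proof.
rewrite /= /dsum_inj_fun; case: pselect => // e.
by rewrite (Prop_irrelevance e erefl).
Qed.

Lemma dsum_inj_ne i j (m : M i) : i <> j -> dsum_inj m j = 0.
Proof. by rewrite /= /dsum_inj_fun; case: pselect. Qed.

Lemma dsum_map_to_inj i (m : M i) : dsum_map_to (dsum_inj m) = g i m.
Proof.
rewrite (@dsum_map_toE _ [:: i]) // => [|j].
  by rewrite big_seq1 dsum_injE.
by rewrite inE => /eqP/nesym; apply: dsum_inj_ne.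
Qed.

End DirectSumMap.

Section CyclicConstant.
Variable k : comNzRingType.

(** Only the edges j and j + 1 of the cycle meet the vertex j, so the coordinate there is q (j + 1)
    - q j. *)
Lemma cyclic_constant t (q : 'I_(nedges t) -> k) : is_affine t ->
  (forall j, \sum_i q i * pcoef k j (proot k i) = 0) -> forall i i', q i = q i'.
Proof.
case: t q => // m q _ q0.
have qS (j : 'I_m.+2) : q (ordS j) = q j.
  apply/eqP; rewrite -subr_eq0; apply/eqP; rewrite -[RHS](q0 j).
  under eq_bigr do rewrite pcoef_root mulrBr.
  rewrite sumrB; congr (_ - _).
    rewrite (bigD1 (ordS j)) //= ordSK eqxx mulr1 big1 ?addr0 // => i ij.
    case: eqP => [ji|_]; last by rewrite mulr0.
    by rewrite ji ord_predK eqxx in ij.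
  rewrite (bigD1 j) //= eqxx mulr1 big1 ?addr0 // => i /negPf ij.
  by rewrite eq_sym ij mulr0.
have q_0 (i : 'I_m.+2) : q i = q ord0.
  case: i => n; elim: n => [|n IH] lt; first by congr q; apply: val_inj.
  rewrite -(IH (ltnW lt)) -[RHS]qS; congr q; apply: val_inj => /=.
  by rewrite modn_small.
by move=> i i'; rewrite q_0 [RHS]q_0.
Qed.

Lemma hcoef_nonaffine t (p : perm_rep_of k t) : ~~ is_affine t -> hcoef k t p = 0.
Proof. by case: t p. Qed.

Variables (V : lmodType k) (x : V).
Definition scale_vec (a : k^o) : V := a *: x.
Fact scale_vec_linear : linear scale_vec.
Proof. by move=> a u v; rewrite /scale_vec scalerDl scalerA. Qed.
HB.instance Definition _ := GRing.isLinear.Build k k^o V _ scale_vec scale_vec_linear.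

End CyclicConstant.

(** * The map from Z and the permutation representations onto V, and its kernel *)

Section Isomorphism.
Variables (k : comNzRingType) (W : groupType) (S : set W).
Variables (V : realization k S) (X H : set V) (xi : V -> {scalar V}).
Hypothesis D : orthant_coords X H xi.
Hypothesis cox : coxeter_system S.
Variable L : forall C : component X, labelling C.
Implicit Types C : component X.
Variable pr : forall C, UMagmaMorphism.type W (weyl (L C)).
Hypothesis pr_edge : forall C i, pr C (val (ledge (L := L) (C := C) i)) = simple_refl i.
Hypothesis pr_out : forall C (s : S), ~ edges_in C s -> pr C (val s) = 1%g.
Variable v : component X -> Zmod H.
Hypothesis vE : forall C, is_affine (L C) -> Zmod_to_span (v C) = root_sum C.

Lemma Zmod_to_spanE (z : Zmod H) :
  Zmod_to_span z = dsum_map_to (fun h : H => scale_vec (val h)) z.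
Proof. by []. Qed.

Lemma Zmod_to_span_H (z : Zmod H) : lspan H (Zmod_to_span z).
Proof.
rewrite Zmod_to_spanE; have [r [ru r0]] := dsum_support z.
rewrite (dsum_map_toE _ ru r0); apply: lspan_sum => h _.
by apply: spanZ; apply: span_inc; apply: set_valP.
Qed.

Lemma Zmod_to_span_inj (z : Zmod H) : Zmod_to_span z = 0 -> z = 0.
Proof.
rewrite Zmod_to_spanE; have [r [ru r0]] := dsum_support z.
rewrite (dsum_map_toE _ ru r0) => z0; apply: dsumP => h /=.
have [hr|] := boolP (h \in r); last by move/r0.
move/(congr1 (xi (val h))): z0; rewrite raddf0 raddf_sum (bigD1_seq h) //=.
rewrite scalarZ (xiE D) ?eqxx ?mulr1; try by right; apply: set_valP.
rewrite big1 ?addr0 // => l lh.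
rewrite scalarZ (xiE D); try by right; apply: set_valP.
by rewrite (inj_eq val_inj) eq_sym (negPf lh) mulr0.
Qed.

Lemma Zmod_to_span_surj w : lspan H w -> exists z : Zmod H, Zmod_to_span z = w.
Proof.
apply: (lspan_ind (P := fun w => exists z : Zmod H, Zmod_to_span z = w)).
- move=> h Hh; pose h' : H := SigSub (mem_set Hh).
  exists (dsum_inj (M := fun _ : H => k^o) (i := h') (1 : k^o) : Zmod H).
  by rewrite Zmod_to_spanE dsum_map_to_inj; apply: (scale1r (val h')).
- move=> a u u' [z <-] [z' <-]; exists (a *: z + z').
  by rewrite !Zmod_to_spanE linearP.
- by exists 0; rewrite Zmod_to_spanE raddf0.
Qed.

(** The existence of [v C] puts [root_sum C] in Span H, so its coordinates at the vertices of C
    vanish; by [cyclic_constant] the units that scale the roots of C are then all equal. *)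
Lemma affine_scaling C : exists a : k, (exists c, c * a = 1) /\
  (is_affine (L C) -> a *: holonomy L C = root_sum C).
Proof.
(* In finite type there is no ħ to match, and 1 is a default. *)
have [aff|_] := boolP (is_affine (L C)); last first.
  by exists 1; split=> //; exists 1; rewrite mulr1.
pose al (i : 'I_(nedges (L C))) : V := simple_root V (ledge i).
pose q i := xi (lvert (edge_src i)) (al i).
have sumE : root_sum C = \sum_i q i *: scaled_root i.
  rewrite /root_sum (fsbig_edges L); apply: eq_bigr => i _.
  by have [_] := root_scaling D i.
have qq : forall i i', q i = q i'.
  apply: cyclic_constant => // j.
  have := xi_lspanH D (lvert_X (L := L) j) (Zmod_to_span_H (v C)).
  rewrite vE // sumE raddf_sum => E; rewrite -[RHS]E; apply: eq_bigr => i _ /=.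
  by rewrite scalarZ -phi_root (xi_phi D).
have i0 : 'I_(nedges (L C)).
  by move: aff; case: (ltype (L C)) => // m _; apply: ord0.
exists (q i0); split.
  by have [cq _] := root_scaling D i0; exists (simple_coroot V (ledge i0) (lvert (edge_src i0))).
move=> _; rewrite -(sum_scaled_root aff) sumE scaler_sumr.
by apply: eq_bigr => i _; rewrite (qq i0 i).
Qed.

Section Scaled.
Variables (a a' : component X -> k).
Hypothesis aK : forall C, a' C * a C = 1.
Hypothesis aE : forall C, is_affine (L C) -> a C *: holonomy L C = root_sum C.

Definition scaled_phi C : {linear PC pr C -> V} := (a C \*: phi L C).

Definition assemble (m : ZP H pr) : V :=
  Zmod_to_span m.1 + dsum_map_to scaled_phi m.2.

Fact assemble_linear : linear assemble.
Proof.
move=> b m m'; rewrite /assemble Zmod_to_spanE !linearP /= scalerDr.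
by rewrite addrACA.
Qed.

HB.instance Definition _ := GRing.isLinear.Build k (ZP H pr) V _
  assemble assemble_linear.

Lemma assembleE m : assemble m = Zmod_to_span m.1 + dsum_map_to scaled_phi m.2.
Proof. by []. Qed.

Lemma assemble_act w m : assemble (ract w m) = ract w (assemble m).
Proof.
have actD (x y : V) : ract w (x + y) = ract w x + ract w y.
  by have := act_linear w 1 x y; rewrite !scale1r.
have actZ c (x : V) : ract w (c *: x) = c *: ract w x.
  by rewrite -[c *: x]addr0 act_linear act0 addr0.
rewrite !assembleE actD (act_span (Hinv D) _ (Zmod_to_span_H _)); congr (_ + _).
case: m => z p /=; have [r [ru r0]] := dsum_support p.
rewrite (dsum_map_toE scaled_phi ru r0).
rewrite (dsum_map_toE scaled_phi (r := r)) // => [|C Cr]; last first.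
  by rewrite /= r0 // act0.
rewrite (big_morph (ract w) actD (act0 V w)); apply: eq_bigr => C _.
rewrite actZ; congr (_ *: _).
exact: (phi_equivariant D cox pr_edge pr_out).
Qed.

Lemma xi_scaled_phi C j C' (p : PC pr C') : C' <> C ->
  xi (lvert (L := L) (C := C) j) (scaled_phi C' p) = 0.
Proof.
move=> CC'; rewrite scalarZ (xi_phi_out D) ?mulr0 //; first exact: lvert_X.
by move=> C'j; apply: CC'; apply: comp_inj C'j (lvert_C j).
Qed.

Lemma xi_assemble C (j : 'I_(nverts (L C))) m :
  xi (lvert j) (assemble m) = a C * pcoef k j (m.2 C).
Proof.
case: m => z p; rewrite assembleE raddfD /=.
rewrite (xi_lspanH D (lvert_X j) (Zmod_to_span_H z)) add0r.
have [r [ru r0]] := dsum_support p; rewrite (dsum_map_toE scaled_phi ru r0) raddf_sum.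
have [Cr|Cr] := boolP (C \in r); last first.
  rewrite r0 // raddf0 mulr0 big_seq big1 // => C' C'r; apply: xi_scaled_phi.
  by move=> E; rewrite -E C'r in Cr.
rewrite (bigD1_seq C) //= big1 ?addr0 => [|C' /eqP]; last exact: xi_scaled_phi.
by rewrite scalarZ (xi_phi D).
Qed.

Lemma assemble_hbar C : is_affine (L C) -> assemble (- v C, hbarC pr C) = 0.
Proof.
move=> aff; rewrite assembleE /= Zmod_to_spanE raddfN /= -Zmod_to_spanE vE //.
rewrite (dsum_map_to_inj scaled_phi).
rewrite (_ : scaled_phi C _ = a C *: phi L C (hbar k (L C))) //.
by rewrite phi_hbar aff scale1r aE // addNr.
Qed.

(** For m in the kernel, subtract the combination [n] of the k_C with the ħ-coordinates of m as
    coefficients. No ħ-coordinate is left; the coordinates at the x_j vanish because the image in V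
    shows them up to a unit. What remains lies in Z, which embeds in V. *)
Lemma assemble_ker m : assemble m = 0 <-> lspan (Kgen (pr := pr) v) m.
Proof.
split; last first.
  apply: (lspan_ind (P := fun m => assemble m = 0)) => [_ [C aff ->]|b u u' u0 u'0|].
  - exact: assemble_hbar.
  - by rewrite linearP /= u0 u'0 scaler0 addr0.
  - exact: raddf0.
move=> m0; have [r [ru r0]] := dsum_support m.2.
pose kC C : ZP H pr := (- v C, hbarC pr C).
pose n : ZP H pr := \sum_(C <- r | is_affine (L C)) hcoef k (L C) (m.2 C) *: kC C.
have nK : lspan (Kgen (pr := pr) v) n.
  by apply: lspan_sum => C aff; apply/spanZ/span_inc; exists C.
suff mn : m - n = 0 by rewrite -[m](subrK n) mn add0r.
have An : assemble n = 0.
  rewrite raddf_sum big1 // => C aff.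
  transitivity (hcoef k (L C) (m.2 C) *: assemble (kC C)); first exact: linearZ.
  by rewrite /kC assemble_hbar // scaler0.
have Amn : assemble (m - n) = 0 by rewrite raddfB /= m0 An subrr.
have n2 C : n.2 C = \sum_(C' <- r | is_affine (L C'))
    hcoef k (L C') (m.2 C') *: dsum_inj (M := PC pr) (hbar k (L C') : PC pr C') C.
  exact: (big_morph (fun u : ZP H pr => u.2 C)).
have mn2 : (m - n).2 = 0.
  apply: dsumP => C; apply: perm_rep_eq => [j|].
    have := xi_assemble j (m - n); rewrite Amn raddf0 => E.
    by rewrite raddf0 -[LHS]mul1r -(aK C) -mulrA -E mulr0.
  rewrite [RHS]raddf0.
  transitivity (hcoef k (L C) (m.2 C) - hcoef k (L C) (n.2 C)).
    exact: raddfB.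
  have [aff|naff] := boolP (is_affine (L C)); last by rewrite !hcoef_nonaffine ?subrr.
  have [Cr|Cr] := boolP (C \in r); last first.
    rewrite n2 r0 // big_seq_cond big1 ?subrr // => C' /andP[C'r _].
    by rewrite dsum_inj_ne ?scaler0 // => E; rewrite -E C'r in Cr.
  have -> : n.2 C = hcoef k (L C) (m.2 C) *: hbar k (L C).
    rewrite n2 (big_rem C) // aff dsum_injE big_seq_cond big1.
      exact: addr0.
    move=> C' /andP[]; rewrite mem_rem_uniq // inE => /andP[/eqP C'C _] _.
    by rewrite dsum_inj_ne ?scaler0.
  by rewrite scalarZ hcoef_hbar aff mulr1 subrr.
have mn1 : (m - n).1 = 0.
  apply: Zmod_to_span_inj; rewrite -[RHS]Amn assembleE mn2.
  by rewrite raddf0 addr0.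
by rewrite [LHS]surjective_pairing mn1 mn2.
Qed.

Lemma assemble_surj x : exists m, assemble m = x.
Proof.
have HA w : lspan H w -> exists m, assemble m = w.
  move=> /Zmod_to_span_surj[z <-]; exists (z, 0).
  by rewrite assembleE raddf0 addr0.
apply: (lspan_ind (P := fun x => exists m, assemble m = x)) (spanXH D x).
- move=> b [Xb|Hb]; last by apply/HA/span_inc.
  have [C [j [h [hH ->]]]] := vertex_decomp D L Xb.
  have [m mE] := HA _ (zspanH_lspan hH).
  (* The factor [a' C] undoes the scaling of [phi] by [a C], and m accounts for the term in Span
     H. *)
  exists ((0, dsum_inj (M := PC pr) (a' C *: pvert k j : PC pr C)) + m).
  rewrite raddfD /= mE; congr (_ + _); rewrite assembleE Zmod_to_spanE raddf0 add0r.
  rewrite (dsum_map_to_inj scaled_phi).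
  rewrite (_ : scaled_phi C _ = a C *: phi L C (a' C *: pvert k j)) //.
  by rewrite linearZ /= scalerA mulrC aK scale1r.
- by move=> b u u' [m <-] [m' <-]; exists (b *: m + m'); rewrite linearP.
- by exists 0; rewrite raddf0.
Qed.

End Scaled.

Lemma decomposition_iso : rep_iso V (ZP_mod_K pr v).
Proof.
have [a aP] := choice affine_scaling.
have [a' a'K] : exists a' : component X -> k, forall C, a' C * a C = 1.
  have a'E C : exists c, c * a C = 1 by have [] := aP C.
  by have [a' a'P] := choice a'E; exists a'.
have aE C : is_affine (L C) -> a C *: holonomy L C = root_sum C.
  by have [_] := aP C.
pose f : {linear ZP H pr -> V} := assemble a.
apply: (rep_iso_quot (@Kgen_invariant _ _ _ _ _ _ _ pr v) (f := f)).
- exact: assemble_act.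
- exact: (assemble_surj a'K).
- exact: (assemble_ker a'K aE).
Qed.

End Isomorphism.

Theorem theorem2p3 (R : realType) (A : {pred R}) (k : GRing.SubComNzRing.type A)
    (W : groupType) (S : set W) (V : realization k S) (X H : set V)
    (hWS : coxeter_system S)
    (hfin : finite_set S \/ finite_set X)
    (hfaith : faithful_rep V)
    (hXH : preserves_almost_orthant X H) :
  (forall C : component X, inhabited (labelling C)) /\
  (forall L : (forall C : component X, labelling C),
     (exists u : S -> k, balanced_scaling H L u) /\
     (exists pr : (forall C, UMagmaMorphism.type W (weyl (L C))),
        product_decomposition pr /\
        (forall v : component X -> Zmod H,
           (forall C, is_affine (L C) -> Zmod_to_span (v C) = root_sum C) ->
           rep_iso V (ZP_mod_K pr v)))).
Proof.
have k_int_inj : injective (fun z : int => z%:~R : k).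
  move=> m n /(congr1 val); rewrite !rmorph_int; exact: intr_inj.
have [XH0 [Lam [[[B [Bb LamE]] _] XHb]] Hinv ortho] := hXH.
have [xi xiP] := zbasis_coord Bb LamE XHb.
have D : orthant_coords X H xi.
  by split=> //; apply: zbasis_span Bb LamE XHb.
split=> [C|L]; first exact: (labelling_exists D hfaith hWS hfin).
split; first exact: (balanced_exists D).
pose prc C := cid (projection_exists D hfaith hWS L C).
pose pr C := projT1 (prc C); have prP C := projT2 (prc C).
have pr_edge C i : pr C (val (ledge i)) = simple_refl i by have [] := prP C.
have pr_out C (s : S) : ~ edges_in C s -> pr C (val s) = 1%g by have [_] := prP C; apply.
exists pr; split; last by move=> v; apply: (decomposition_iso D).
exact: (product_decomposition_of_projections D hfaith hWS hfin).
Qed.
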